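(* Consider diffusive deposition started from the empty configuration $\sigma(0)=(0,\dots,0)$. There exist constants $0<\alpha<\beta$ and $\chi>0$ such that, with probability at least $1-\varepsilon_N$ where $\sum_N\varepsilon_N<\infty$ (in the paper's words: almost surely, for all $N$ large enough), $$\max_{i\in G_N}\sigma_i\Big(\Big\lfloor\frac{\alpha N}{\log N}\Big\rfloor\Big)\le 3\log N \quad\text{and}\quad \max_{i\in G_N}\sigma_i\Big(\Big\lfloor\frac{\beta N}{\log N}\Big\rfloor\Big)\ge N^{\chi}.$$
   Context: Deposition models. Fix an integer $N\ge2$ and let $G_N=\{1,\dots,N\}$. A configuration is $\sigma=(\sigma_1,\dots,\sigma_N)\in\mathbb N^N$ ($\mathbb N=\{0,1,2,\dots\}$), $\sigma_i$ being the height of column (pile) $i$; the corresponding cluster is $\bigcup_i\{i\}\times\{0,\dots,\sigma_i\}\subset G_N\times\mathbb N$ (so the ground $G_N\times\{0\}$ always belongs to it). Write $|\sigma|=\sum_i\sigma_i$. Given the current configuration $\sigma$, an explorer is a walk $S_n=(X_n,Z_n)$, $n\ge0$, where $(X_n)_{n\ge0}$ are i.i.d. uniform on $G_N$, $Z_0=\max_i\sigma_i+1$, and for diffusive deposition $(Z_{n+1}-Z_n)_{n\ge0}$ are i.i.d. uniform on $\{-1,+1\}$ independent of $(X_n)$, while for ballistic deposition $Z_{n+1}-Z_n=-1$ for all $n$. Let $n^*=\inf\{n\ge0:Z_n\le\sigma_{X_n}\}$ and $(X^*,Z^* )=(X_{n^*},Z_{n^*})$ (the hitting site); the explorer attaches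 to column $X^*$, i.e. the new configuration is $\sigma+e_{X^*}$. Explorers are sent one at a time, independently, and $\sigma(t)$ denotes the configuration after $t$ explorers have been sent. *)

(* Defs.v *)
From Stdlib Require Import Reals ZArith Arith ClassicalEpsilon.
Open Scope R_scope.

(* A configuration on G_N is a function c : nat -> nat; column i in {1..N}
   is represented by index i-1 in {0..N-1}; values at indices >= N are ignored. *)
Definition config := nat -> nat.

Fixpoint maxh (n : nat) (c : config) : nat :=
  match n with O => O | S m => Nat.max (c m) (maxh m c) end.

Definition incr (c : config) (i : nat) : config :=
  fun j => if Nat.eqb j i then S (c j) else c j.

Fixpoint count_below (n : nat) (c : config) (z : Z) : nat :=
  match n with
  | O => O
  | S m => (if Z.ltb (Z.of_nat (c m)) z then 1 else 0) + count_below m c z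
  end%nat.

(* probability that the explorer is NOT absorbed at a time when it is at height z:
   P(Z > sigma_X) with X uniform on G_N *)
Definition survive (N : nat) (c : config) (z : Z) : R :=
  INR (count_below N c z) / INR N.

(* f N c n z = P(n* >= n and Z_n = z) for diffusive deposition from c *)
Fixpoint fsurv (N : nat) (c : config) (n : nat) (z : Z) : R :=
  match n with
  | O => if Z.eqb z (Z.of_nat (maxh N c) + 1)%Z then 1 else 0
  | S m => / 2 * (fsurv N c m (z - 1)%Z * survive N c (z - 1)%Z
                 + fsurv N c m (z + 1)%Z * survive N c (z + 1)%Z)
  end.

(* P(n* = n and X* = i): Z_n lies in [H+1-n, H+1+n], and hitting column i
   at time n means X_n = i (prob 1/N) and Z_n <= sigma_i. *)
Definition hit_term (N : nat) (c : config) (i : nat) (n : nat) : R :=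
  sum_f_R0 (fun k =>
    let z := (Z.of_nat (maxh N c) + 1 - Z.of_nat n + Z.of_nat k)%Z in
    fsurv N c n z * (if Z.leb z (Z.of_nat (c i)) then 1 else 0) / INR N)
    (2 * n).

(* K N c i = P(X* = i) = sum_n P(n* = n, X* = i) *)
Definition K (N : nat) (c : config) (i : nat) : R :=
  epsilon (inhabits 0) (fun l => infinite_sum (hit_term N c i) l).

(* Ev N t F c = E[F(sigma(t))] for the chain started at sigma(0) = c *)
Fixpoint Ev (N : nat) (t : nat) (F : config -> R) (c : config) : R :=
  match t with
  | O => F c
  | S s => sum_f_R0 (fun i => K N c i * Ev N s F (incr c i)) (N - 1)
  end.

Definition ind (b : Prop) (d : {b} + {~ b}) : R := if d then 1 else 0.

Definition empty_config : config := fun _ => 0%nat.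

Definition floorR (x : R) : nat := Z.to_nat (Int_part x).

Definition t_of (a : R) (N : nat) : nat := floorR (a * INR N / ln (INR N)).

(* P( max sigma(t1) <= 3 log N  and  max sigma(t2) >= N^chi ), t1 <= t2,
   computed via the Markov property. *)
Definition event_prob (N : nat) (alpha beta chi : R) : R :=
  let t1 := t_of alpha N in
  let t2 := t_of beta N in
  Ev N t1 (fun c =>
     ind _ (Rle_dec (INR (maxh N c)) (3 * ln (INR N))) *
     Ev N (t2 - t1) (fun d =>
        ind _ (Rle_dec (Rpower (INR N) chi) (INR (maxh N d)))) c)
   empty_config.

(* Main.v *)
(* The walk of an explorer is recurrent, so it is absorbed almost surely.  Its Green
   function satisfies G(z) <= 2 z, and G(z) >= z below the top as long as the energy
   sum_i s_i (s_i + 1) is at most N / 2, because the mass absorbed above the ground is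
   then at most 1/2.  A column of height h thus grows with probability between
   (1 + h + h^2) / (2 N) and (1 + h + h^2) / N.

   Let Phi solve (1 + h + h^2) (Phi(h+1) - Phi(h)) = m^2 Phi(h), Phi(0) = 1; then
   Phi <= exp(5 m).  For small C and suitable r > 1 close to 1, the process
   exp(C r^(-t) sum_i Phi(s_i(t))) is a supermartingale, and so is the same expression
   with -C, with another r and as long as the energy is low.  With m a multiple of
   log N, the first one bounds the number of tall columns (Markov), and the second one
   shows that at time beta N / log N the energy exceeds N / 2, which cannot be due to
   columns of height O(log N) only, and is not due to the few taller columns if these
   are all below N^chi. *)
Require Import Defs.
From Stdlib Require Import Reals ZArith Arith ClassicalEpsilon Lra Lia.
From Coquelicot Require ElemFct.
Open Scope R_scope.

(** * Finite sums and limits *)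

Fixpoint bsum (n : nat) (f : nat -> R) : R :=
  match n with O => 0 | S m => bsum m f + f m end.

Lemma sum_f_R0_bsum f n : sum_f_R0 f n = bsum (S n) f.
Proof. induction n as [|n IH]; simpl in *; lra. Qed.

Lemma bsum_ext n f g :
  (forall i, (i < n)%nat -> f i = g i) -> bsum n f = bsum n g.
Proof.
  induction n as [|n IH]; intros H; simpl; [reflexivity|].
  rewrite IH by (intros; apply H; lia). now rewrite H by lia.
Qed.

Lemma bsum_le n f g :
  (forall i, (i < n)%nat -> f i <= g i) -> bsum n f <= bsum n g.
Proof.
  induction n as [|n IH]; intros H; simpl; [lra|].
  assert (bsum n f <= bsum n g) by (apply IH; intros; apply H; lia).
  assert (f n <= g n) by (apply H; lia). lra.
Qed.

Lemma bsum_const n a : bsum n (fun _ => a) = INR n * a.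
Proof. induction n as [|n IH]; [simpl; lra|]. cbn [bsum]. rewrite IH, S_INR. lra. Qed.

Lemma bsum_0 n f : (forall i, (i < n)%nat -> f i = 0) -> bsum n f = 0.
Proof. intros H. rewrite (bsum_ext n f (fun _ => 0) H), bsum_const. lra. Qed.

Lemma bsum_nonneg n f : (forall i, (i < n)%nat -> 0 <= f i) -> 0 <= bsum n f.
Proof.
  intros H. rewrite <- (bsum_0 n (fun _ => 0)) by reflexivity.
  now apply bsum_le.
Qed.

Lemma bsum_plus n f g : bsum n (fun i => f i + g i) = bsum n f + bsum n g.
Proof. induction n as [|n IH]; simpl; lra. Qed.

Lemma bsum_scal n a f : bsum n (fun i => a * f i) = a * bsum n f.
Proof. induction n as [|n IH]; simpl; [|rewrite IH]; lra. Qed.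

Lemma bsum_minus n f g : bsum n (fun i => f i - g i) = bsum n f - bsum n g.
Proof. induction n as [|n IH]; simpl; lra. Qed.

Lemma bsum_swap n m f :
  bsum n (fun i => bsum m (fun j => f i j)) = bsum m (fun j => bsum n (fun i => f i j)).
Proof.
  induction n as [|n IH]; simpl.
  - now rewrite bsum_0.
  - now rewrite IH, <- bsum_plus.
Qed.

Lemma bsum_split n m f : bsum (n + m) f = bsum n f + bsum m (fun i => f (n + i)%nat).
Proof.
  induction m as [|m IH]; simpl.
  - rewrite Nat.add_0_r. lra.
  - rewrite Nat.add_succ_r. simpl. rewrite IH. lra.
Qed.

Lemma bsum_S_first n f : bsum (S n) f = f 0%nat + bsum n (fun i => f (S i)).
Proof. change (S n) with (1 + n)%nat. rewrite bsum_split. simpl. lra. Qed.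

Lemma bsum_trunc n m f :
  (n <= m)%nat -> (forall i, (n <= i < m)%nat -> f i = 0) -> bsum m f = bsum n f.
Proof.
  intros Hnm H. replace m with (n + (m - n))%nat by lia.
  rewrite bsum_split, (bsum_0 (m - n)); [lra|]. intros; apply H; lia.
Qed.

Lemma bsum_single n f i :
  (i < n)%nat -> (forall j, (j < n)%nat -> 0 <= f j) -> f i <= bsum n f.
Proof.
  intros Hi Hf. induction n as [|n IH]; [lia|]. simpl.
  assert (0 <= bsum n f) by (apply bsum_nonneg; intros; apply Hf; lia).
  assert (0 <= f n) by (apply Hf; lia).
  destruct (Nat.eq_dec i n) as [->|]; [lra|].
  assert (f i <= bsum n f) by (apply IH; [lia|intros; apply Hf; lia]). lra.
Qed.

Lemma bsum_incr n c i (w : nat -> R) :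
  (i < n)%nat ->
  bsum n (fun j => w (incr c i j)) = bsum n (fun j => w (c j)) + (w (S (c i)) - w (c i)).
Proof.
  induction n as [|n IH]; intros Hi; [lia|]. simpl. unfold incr at 2.
  destruct (Nat.eqb_spec n i) as [->|Hne].
  - rewrite (bsum_ext i (fun j => w (incr c i j)) (fun j => w (c j))); [lra|].
    intros j Hj. unfold incr. destruct (Nat.eqb_spec j i); [lia|reflexivity].
  - rewrite IH by lia. lra.
Qed.

(* Summation by parts on the half line, [a] playing the role of a measure that
   vanishes at [0]. *)
Lemma bsum_neighbours M a phi :
  a 0%nat = 0 -> a M = 0 -> a (S M) = 0 ->
  bsum (S M) (fun z => (match z with O => 0 | S y => a y end + a (S z)) * phi z)
  = bsum M (fun z => a z * (phi (pred z) + phi (S z))).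
Proof.
  intros H0 HM HM1.
  transitivity (bsum (S M) (fun z => match z with O => 0 | S y => a y end * phi z)
                + bsum (S M) (fun z => a (S z) * phi z)).
  { rewrite <- bsum_plus. apply bsum_ext. intros; ring. }
  rewrite bsum_S_first.
  assert (E : bsum (S M) (fun z => a (S z) * phi z) = bsum M (fun z => a z * phi (pred z))).
  { assert (E1 := bsum_S_first (S M) (fun z => a z * phi (pred z))).
    simpl in E1 |- *. rewrite H0, HM, HM1 in E1. rewrite HM1. lra. }
  rewrite E.
  rewrite (bsum_ext M (fun z => a z * (phi (pred z) + phi (S z)))
             (fun z => a z * phi (S z) + a z * phi (pred z))) by (intros; ring).
  rewrite bsum_plus. ring.
Qed.

Lemma Un_cv_bsum k (u : nat -> nat -> R) (l : nat -> R) :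
  (forall z, Un_cv (u z) (l z)) ->
  Un_cv (fun n => bsum k (fun z => u z n)) (bsum k l).
Proof.
  intros H. induction k as [|k IH]; simpl.
  - intros e He. exists 0%nat. intros. unfold Rdist. rewrite Rminus_diag, Rabs_R0. lra.
  - now apply CV_plus.
Qed.

Lemma Un_cv_const a : Un_cv (fun _ => a) a.
Proof.
  intros e He. exists 0%nat. intros. unfold Rdist. rewrite Rminus_diag, Rabs_R0. lra.
Qed.

Lemma Un_cv_scal a u l : Un_cv u l -> Un_cv (fun n => a * u n) (a * l).
Proof. intros H. apply CV_mult; [apply Un_cv_const | exact H]. Qed.

Lemma Un_cv_ext u v l : (forall n, u n = v n) -> Un_cv u l -> Un_cv v l.
Proof.
  intros E H e He. destruct (H e He) as [n0 Hn]. exists n0. intros n Hn0.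
  rewrite <- E. now apply Hn.
Qed.

Lemma Un_cv_shift u l : Un_cv u l -> Un_cv (fun n => u (S n)) l.
Proof.
  intros H e He. destruct (H e He) as [n0 Hn]. exists n0. intros. apply Hn. lia.
Qed.

Lemma Un_cv_le_const u l b : (forall n, u n <= b) -> Un_cv u l -> l <= b.
Proof. intros H Hu. exact (Rle_cv_lim H Hu (Un_cv_const b)). Qed.

Lemma bounded_series_cv f b :
  (forall n, 0 <= f n) -> (forall n, bsum n f <= b) ->
  exists l, Un_cv (fun n => bsum n f) l.
Proof.
  intros Hf Hb. destruct (Un_cv_crit (fun n => bsum n f)) as [l Hl].
  - intros n. simpl. specialize (Hf n). lra.
  - exists b. intros x [n ->]. apply Hb.
  - now exists l.
Qed.

Lemma cv_series_term f l : Un_cv (fun n => bsum n f) l -> Un_cv f 0.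
Proof.
  intros H. replace 0 with (l - l) by ring.
  apply (Un_cv_ext (fun n => bsum (S n) f - bsum n f)).
  - intros; simpl; ring.
  - apply CV_minus; [now apply Un_cv_shift in H | exact H].
Qed.

(** * Green function of an explorer *)

Lemma INR_count_below n c z :
  INR (count_below n c z) = bsum n (fun i => if Z.ltb (Z.of_nat (c i)) z then 1 else 0).
Proof.
  induction n as [|n IH]; simpl count_below; simpl bsum; [reflexivity|].
  rewrite plus_INR, IH. destruct (Z.ltb _ _); simpl; lra.
Qed.

Lemma maxh_ge n c i : (i < n)%nat -> (c i <= maxh n c)%nat.
Proof.
  induction n as [|n IH]; intros Hi; [lia|]. simpl.
  destruct (Nat.eq_dec i n) as [->|]; [lia|]. specialize (IH ltac:(lia)). lia.
Qed.

Lemma maxh_attained n c : (0 < n)%nat -> exists i, (i < n)%nat /\ c i = maxh n c.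
Proof.
  induction n as [|n IH]; intros Hn; [lia|]. simpl.
  destruct (le_lt_dec (maxh n c) (c n)) as [H|H].
  - exists n. split; lia.
  - destruct n as [|n]; [simpl in H; lia|].
    destruct IH as [i [Hi E]]; [lia|]. exists i. split; lia.
Qed.

Section Explorer.

Variables (N : nat) (c : config).
Hypothesis N_pos : (0 < N)%nat.

Let H := maxh N c.
(** Natural heights suffice: negative ones carry no mass by [fsurv_neg]. *)
Let f n z := fsurv N c n (Z.of_nat z).
Let s z := survive N c (Z.of_nat z).

Lemma INR_N_pos : 0 < INR N.
Proof. now apply lt_0_INR. Qed.
#[local] Hint Resolve INR_N_pos : core.

Lemma survive_nonpos z : (z <= 0)%Z -> survive N c z = 0.
Proof.
  intros Hz. unfold survive. rewrite INR_count_below, bsum_0; [unfold Rdiv; ring|].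
  intros i _. destruct (Z.ltb_spec (Z.of_nat (c i)) z); [lia|reflexivity].
Qed.

Lemma survive_killed z :
  1 - survive N c (Z.of_nat z)
  = / INR N * bsum N (fun i => if Nat.leb z (c i) then 1 else 0).
Proof.
  unfold survive. rewrite INR_count_below.
  assert (E : bsum N (fun i => if Nat.leb z (c i) then 1 else 0) = INR N -
     bsum N (fun i => if Z.ltb (Z.of_nat (c i)) (Z.of_nat z) then 1 else 0)).
  { rewrite <- (Rmult_1_r (INR N)), <- (bsum_const N 1), <- bsum_minus.
    apply bsum_ext. intros i _.
    destruct (Nat.leb_spec z (c i)), (Z.ltb_spec (Z.of_nat (c i)) (Z.of_nat z));
      try lia; lra. }
  rewrite E. field. apply Rgt_not_eq, INR_N_pos.
Qed.

Lemma survive_bounds z : 0 <= survive N c z <= 1.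
Proof.
  assert (HN := INR_N_pos). unfold survive. rewrite INR_count_below. split.
  - apply Rle_mult_inv_pos; [|exact HN]. apply bsum_nonneg.
    intros i _. destruct (Z.ltb _ _); lra.
  - apply Rmult_le_reg_r with (INR N); [exact HN|].
    unfold Rdiv. rewrite Rmult_assoc, Rinv_l, Rmult_1_r, Rmult_1_l by lra.
    replace (INR N) with (bsum N (fun _ => 1)) by (rewrite bsum_const; ring).
    apply bsum_le. intros i _. destruct (Z.ltb _ _); lra.
Qed.

Lemma survive_above z : (H < z)%nat -> s z = 1.
Proof.
  intros Hz. enough (1 - s z = 0) by lra. unfold s. rewrite survive_killed, bsum_0; [ring|].
  intros i Hi. assert (Hc := maxh_ge N c i Hi). fold H in Hc.
  destruct (Nat.leb_spec z (c i)); [lia|reflexivity].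
Qed.

Lemma fsurv_nonneg n z : 0 <= fsurv N c n z.
Proof.
  revert z. induction n as [|n IH]; intros z; simpl.
  - destruct (Z.eqb _ _); lra.
  - assert (A := IH (z - 1)%Z). assert (B := IH (z + 1)%Z).
    assert (C := survive_bounds (z - 1)). assert (D := survive_bounds (z + 1)). nra.
Qed.

Lemma fsurv_neg n z : (z < 0)%Z -> fsurv N c n z = 0.
Proof.
  intros Hz. destruct n as [|n]; simpl.
  - destruct (Z.eqb_spec z (Z.of_nat (maxh N c) + 1)); [lia|reflexivity].
  - rewrite !survive_nonpos by lia. ring.
Qed.

Lemma fsurv_far n z :
  (Z.of_nat n < Z.abs (z - (Z.of_nat H + 1)))%Z -> fsurv N c n z = 0.
Proof.
  revert z. induction n as [|n IH]; intros z Hz; simpl; fold H.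
  - destruct (Z.eqb_spec z (Z.of_nat H + 1)); [lia|reflexivity].
  - rewrite !IH by lia. ring.
Qed.

Lemma f_far n z : (H + 2 + n <= z)%nat -> f n z = 0.
Proof. intros. apply fsurv_far. lia. Qed.

Lemma f_step n z :
  f (S n) z = / 2 * (match z with O => 0 | S y => f n y * s y end + f n (S z) * s (S z)).
Proof.
  unfold f, s. cbn [fsurv]. replace (Z.of_nat z + 1)%Z with (Z.of_nat (S z)) by lia.
  destruct z as [|y].
  - rewrite (survive_nonpos (Z.of_nat 0 - 1)) by lia. ring.
  - now replace (Z.of_nat (S y) - 1)%Z with (Z.of_nat y) by lia.
Qed.

(** Expectation of [phi (Z_n)] on the event that the explorer is not absorbed before time [n]; by
    [f_far] the cut-off loses no mass. *)
Let E n phi := bsum (H + 2 + n) (fun z => f n z * phi z).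

Lemma E_start phi : E 0 phi = phi (S H).
Proof.
  assert (F0 : forall z, f 0 z = if Nat.eqb z (S H) then 1 else 0).
  { intros z. unfold f. cbn [fsurv]. fold H.
    destruct (Z.eqb_spec (Z.of_nat z) (Z.of_nat H + 1)), (Nat.eqb_spec z (S H));
      reflexivity || lia. }
  unfold E. replace (H + 2 + 0)%nat with (S (S H)) by lia. cbn [bsum].
  rewrite bsum_0, !F0.
  - rewrite Nat.eqb_refl. destruct (Nat.eqb_spec H (S H)); [lia|ring].
  - intros i Hi. rewrite F0. destruct (Nat.eqb_spec i (S H)); [lia|ring].
Qed.

(** By [bsum_neighbours] the transition moves from the law onto the test function. The value
    [pred 0 = 0] is harmless because [s 0 = 0]. *)
Lemma E_step n phi :
  E (S n) phi = bsum (H + 2 + n) (fun z => f n z * (s z * ((phi (pred z) + phi (S z)) / 2))).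
Proof.
  unfold E. replace (H + 2 + S n)%nat with (S (H + 2 + n)) by lia.
  assert (B := bsum_neighbours (H + 2 + n) (fun z => f n z * s z) phi).
  assert (B0 : f n 0 * s 0%nat = 0).
  { unfold s. rewrite survive_nonpos by (simpl; lia). ring. }
  assert (Bfar : forall z, (H + 2 + n <= z)%nat -> f n z * s z = 0).
  { intros z Hz. rewrite f_far by exact Hz. ring. }
  specialize (B B0 (Bfar _ (le_n _)) (Bfar _ (le_S _ _ (le_n _)))).
  rewrite (bsum_ext _ _ (fun z => / 2 * ((match z with O => 0 | S y => f n y * s y end
       + f n (S z) * s (S z)) * phi z))).
  - rewrite bsum_scal, B, <- bsum_scal. apply bsum_ext. intros. field.
  - intros i _. rewrite f_step. ring.
Qed.

(* [phi] is superharmonic for the killed walk, with defect at least [chi]. *)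
Lemma superharmonic_bound phi chi :
  (forall z, 0 <= phi z) ->
  (forall z, s z * ((phi (pred z) + phi (S z)) / 2) + chi z <= phi z) ->
  forall M, bsum M (fun n => E n chi) + E M phi <= phi (S H).
Proof.
  intros Hphi Hsup M. induction M as [|M IH].
  - simpl. rewrite E_start. lra.
  - cbn [bsum]. enough (E M chi + E (S M) phi <= E M phi) by lra.
    rewrite E_step. unfold E. rewrite <- bsum_plus. apply bsum_le. intros z _.
    assert (F := fsurv_nonneg M (Z.of_nat z)). fold (f M z) in F.
    specialize (Hsup z). nra.
Qed.

Lemma E_nonneg n phi : (forall z, 0 <= phi z) -> 0 <= E n phi.
Proof.
  intros Hp. apply bsum_nonneg. intros z _. apply Rmult_le_pos; [apply fsurv_nonneg|apply Hp].
Qed.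

Lemma E_point n y : E n (fun z => if Nat.eqb z y then 1 else 0) = f n y.
Proof.
  assert (G : forall k, bsum k (fun z => f n z * (if Nat.eqb z y then 1 else 0))
               = if Nat.ltb y k then f n y else 0).
  { induction k as [|k IH]; simpl; [reflexivity|]. rewrite IH.
    destruct (Nat.ltb_spec y k), (Nat.ltb_spec y (S k)), (Nat.eqb_spec k y);
      subst; try lia; lra. }
  unfold E. rewrite G. destruct (Nat.ltb_spec y (H + 2 + n)); [reflexivity|].
  rewrite f_far; [reflexivity|lia].
Qed.

(** Green function at [y] of the simple walk killed only at the ground and started at or above
    [y]. *)
Definition visit_bound (y : nat) : R := match y with O => 1 | S _ => 2 * INR y end.

(** Test functions for [superharmonic_bound]: the constant [1] if [y] is the ground, where the
    explorer dies, and otherwise [z |-> 2 min(z, y)], whose kink at [y] yields the defect [1]. *)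
Lemma visits_partial M y : bsum M (fun n => f n y) <= visit_bound y.
Proof.
  assert (B : forall phi, (forall z, 0 <= phi z) -> (forall z,
       s z * ((phi (pred z) + phi (S z)) / 2) + (if Nat.eqb z y then 1 else 0) <= phi z) ->
       bsum M (fun n => f n y) <= phi (S H)).
  { intros phi Hp Hs. assert (B := superharmonic_bound phi _ Hp Hs M).
    assert (P := E_nonneg M phi Hp).
    rewrite (bsum_ext M (fun n => f n y) (fun n => E n (fun z => if Nat.eqb z y then 1 else 0)));
      [lra|]. intros; now rewrite E_point. }
  assert (S0 : s 0%nat = 0) by (apply survive_nonpos; simpl; lia).
  destruct y as [|y].
  - apply (B (fun _ => 1)); [intros; lra|]. intros z.
    destruct z as [|z]; [rewrite S0; simpl; lra|].
    assert (X := survive_bounds (Z.of_nat (S z))). fold (s (S z)) in X. simpl. lra.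
  - apply Rle_trans with (2 * INR (Nat.min (S H) (S y))).
    + apply (B (fun z => 2 * INR (Nat.min z (S y)))).
      * intros z. assert (P := pos_INR (Nat.min z (S y))). lra.
      * intros z. destruct z as [|z]; [rewrite S0; simpl; lra|].
        assert (X := survive_bounds (Z.of_nat (S z))). fold (s (S z)) in X.
        assert (P := pos_INR z). assert (P' := pos_INR y).
        change (pred (S z)) with z.
        destruct (Nat.eqb_spec (S z) (S y)) as [Heq|Hne].
        -- assert (z = y) by lia. subst z.
           rewrite (Nat.min_l y), (Nat.min_r (S (S y))), (Nat.min_l (S y)) by lia.
           rewrite !S_INR. nra.
        -- destruct (le_lt_dec (S z) y).
           ++ rewrite (Nat.min_l z), (Nat.min_l (S (S z))), (Nat.min_l (S z)) by lia.
              rewrite !S_INR. nra.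
           ++ rewrite (Nat.min_r z), (Nat.min_r (S (S z))), (Nat.min_r (S z)) by lia.
              rewrite !S_INR. nra.
    + unfold visit_bound. apply Rmult_le_compat_l; [lra|]. apply le_INR. lia.
Qed.

(* Expected number of visits at height [z] up to the hitting time. *)
Definition green (z : nat) : R :=
  epsilon (inhabits 0) (fun l => Un_cv (fun M => bsum M (fun n => f n z)) l).

Lemma green_cv z : Un_cv (fun M => bsum M (fun n => f n z)) (green z).
Proof.
  unfold green. apply epsilon_spec. apply bounded_series_cv with (visit_bound z).
  - intros; apply fsurv_nonneg.
  - intros; apply visits_partial.
Qed.

Lemma green_nonneg z : 0 <= green z.
Proof.
  apply (Rle_cv_lim (Un := fun _ => 0) (Vn := fun M => bsum M (fun n => f n z)));
    [|apply Un_cv_const|apply green_cv].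
  intros M. apply bsum_nonneg. intros; apply fsurv_nonneg.
Qed.

Lemma green_le z : green z <= visit_bound z.
Proof. exact (Un_cv_le_const _ _ _ (fun M => visits_partial M z) (green_cv z)). Qed.

(* Recurrence: by superharmonicity of [min z R] the walk seldom is above [R], and
   it leaves every finite set of heights because the Green function is finite. *)
Lemma survival_vanishes : Un_cv (fun n => E n (fun _ => 1)) 0.
Proof.
  intros e He.
  (* Since [min(Z_n, L)] has mean at most [H + 1], such an [L] leaves mass less than [e / 2] at
     heights [L] and above. *)
  destruct (INR_unbounded (2 * (INR H + 1) / e)) as [L HL].
  assert (PH := pos_INR H).
  assert (PL : 0 < INR L).
  { apply Rle_lt_trans with (2 * (INR H + 1) / e); [|lra].
    apply Rle_mult_inv_pos; lra. }
  assert (T : Un_cv (fun n => bsum L (fun z => f n z)) (bsum L (fun _ => 0))).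
  { apply (Un_cv_bsum L (fun z n => f n z)). intros z. exact (cv_series_term _ _ (green_cv z)). }
  rewrite bsum_0 in T by reflexivity.
  destruct (T (e / 2)) as [n0 Hn0]; [lra|]. exists n0. intros n Hn.
  specialize (Hn0 n Hn). unfold Rdist in *. rewrite Rminus_0_r in *.
  assert (P : 0 <= E n (fun _ => 1)) by (apply E_nonneg; intros; lra).
  rewrite Rabs_pos_eq by exact P. apply Rabs_def2 in Hn0.
  assert (B := superharmonic_bound (fun z => INR (Nat.min z L)) (fun _ => 0)).
  specialize (B (fun z => pos_INR _)).
  assert (Hs : forall z, s z * ((INR (Nat.min (pred z) L) + INR (Nat.min (S z) L)) / 2) + 0
                   <= INR (Nat.min z L)).
  { intros z. assert (X := survive_bounds (Z.of_nat z)). fold (s z) in X.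
    destruct z as [|z].
    - replace (s 0%nat) with 0 by (symmetry; apply survive_nonpos; simpl; lia). simpl. lra.
    - assert (A : INR (Nat.min z L) + INR (Nat.min (S (S z)) L) <= 2 * INR (Nat.min (S z) L)).
      { rewrite <- plus_INR. change 2 with (INR 2). rewrite <- mult_INR. apply le_INR. lia. }
      simpl pred. assert (Q := pos_INR (Nat.min (S z) L)).
      assert (Q' := pos_INR (Nat.min z L)). assert (Q'' := pos_INR (Nat.min (S (S z)) L)). nra. }
  specialize (B Hs n).
  assert (Z0 : bsum n (fun n => E n (fun _ => 0)) = 0).
  { apply bsum_0. intros. apply bsum_0. intros; ring. }
  rewrite Z0 in B.
  (* Markov's inequality: [L] is at most [min(z, L)], plus [L] when [z < L]. *)
  assert (C : INR L * E n (fun _ => 1)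
     <= E n (fun z => INR (Nat.min z L)) + INR L * bsum L (fun z => f n z)).
  { assert (M : bsum L (fun z => f n z) >=
        bsum (H + 2 + n) (fun z => f n z * (if Nat.ltb z L then 1 else 0))).
    { destruct (le_lt_dec L (H + 2 + n)) as [l|l].
      - rewrite (bsum_trunc L (H + 2 + n)) by
          (exact l || (intros i Hi; destruct (Nat.ltb_spec i L); lia || ring)).
        apply Req_ge. apply bsum_ext. intros i Hi. destruct (Nat.ltb_spec i L); [ring|lia].
      - rewrite (bsum_trunc (H + 2 + n) L) by (try lia; intros; apply f_far; lia).
        apply Req_ge. apply bsum_ext. intros i Hi. destruct (Nat.ltb_spec i L); [ring|lia]. }
    apply Rle_trans with (E n (fun z => INR (Nat.min z L)) +
       INR L * bsum (H + 2 + n) (fun z => f n z * (if Nat.ltb z L then 1 else 0))); [|nra].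
    unfold E. rewrite <- !bsum_scal, <- bsum_plus. apply bsum_le. intros z _.
    assert (F := fsurv_nonneg n (Z.of_nat z)). fold (f n z) in F.
    destruct (Nat.ltb_spec z L).
    - assert (Q := pos_INR (Nat.min z L)). nra.
    - rewrite Nat.min_r by lia. nra. }
  assert (D : INR (Nat.min (S H) L) <= INR H + 1) by (rewrite <- S_INR; apply le_INR; lia).
  assert (F : 2 * (INR H + 1) < e * INR L).
  { apply Rmult_lt_reg_l with (/ e); [now apply Rinv_0_lt_compat|].
    replace (/ e * (e * INR L)) with (INR L) by (field; lra).
    replace (/ e * (2 * (INR H + 1))) with (2 * (INR H + 1) / e) by (unfold Rdiv; ring). lra. }
  apply Rmult_lt_reg_l with (INR L); [exact PL|]. nra.
Qed.

(** Mass is conserved: what is killed at time [n] is the drop of [E n 1], so the partial sums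
    telescope to [1 - E M 1], and [survival_vanishes] concludes. Heights above [H] kill nothing. *)
Lemma green_killed_total : bsum (S H) (fun z => green z * (1 - s z)) = 1.
Proof.
  assert (A : forall M, bsum (S H) (fun z => (1 - s z) * bsum M (fun n => f n z))
                = 1 - E M (fun _ => 1)).
  { intros M. induction M as [|M IH].
    - rewrite E_start, bsum_0; [ring|]. intros; simpl; ring.
    - rewrite (bsum_ext _ _ (fun z => (1 - s z) * bsum M (fun n => f n z) + (1 - s z) * f M z))
        by (intros; cbn [bsum]; ring).
      rewrite bsum_plus, IH, E_step. unfold E.
      rewrite <- (bsum_trunc (S H) (H + 2 + M)).
      + assert (X : bsum (H + 2 + M) (fun i => (1 - s i) * f M i)
          = bsum (H + 2 + M) (fun z => f M z * 1)
            - bsum (H + 2 + M) (fun z => f M z * (s z * ((1 + 1) / 2)))).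
        { rewrite <- bsum_minus. apply bsum_ext. intros; field. }
        rewrite X. ring.
      + lia.
      + intros z Hz. rewrite survive_above by lia. ring. }
  rewrite (bsum_ext _ _ (fun z => (1 - s z) * green z)) by (intros; ring).
  apply (UL_sequence (fun M => bsum (S H) (fun z => (1 - s z) * bsum M (fun n => f n z)))).
  - apply Un_cv_bsum. intros z. apply Un_cv_scal, green_cv.
  - apply (Un_cv_ext (fun M => 1 - E M (fun _ => 1))); [intros; now rewrite A|].
    rewrite <- (Rminus_0_r 1) at 1.
    exact (CV_minus _ _ _ _ (Un_cv_const 1) survival_vanishes).
Qed.

(** Summation of [f_step] over time. There is no source term because the explorer starts at [H + 1],
    above [z]. *)
Lemma green_eq z :
  (z <= H)%nat ->
  green z = / 2 * (match z with O => 0 | S y => green y * s y end + green (S z) * s (S z)).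
Proof.
  intros Hz. apply (UL_sequence (fun M => bsum (S M) (fun n => f n z))).
  - apply (Un_cv_shift (fun M => bsum M (fun n => f n z))), green_cv.
  - apply (Un_cv_ext (fun M => / 2 * (match z with O => 0 | S y => s y * bsum M (fun n => f n y) end
        + s (S z) * bsum M (fun n => f n (S z))))).
    + intros M. rewrite bsum_S_first.
      replace (f 0%nat z) with 0.
      2:{ unfold f. symmetry. apply fsurv_far. lia. }
      rewrite Rplus_0_l, (bsum_ext M _ _ (fun n _ => f_step n z)), bsum_scal, bsum_plus.
      rewrite (bsum_ext M (fun i => f i (S z) * s (S z)) (fun i => s (S z) * f i (S z)))
        by (intros; ring).
      rewrite bsum_scal. f_equal. f_equal. destruct z as [|y].
      * now rewrite bsum_0.
      * rewrite <- bsum_scal. apply bsum_ext. intros; ring.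
    + apply Un_cv_scal, CV_plus.
      * destruct z as [|y]; [apply Un_cv_const|]. rewrite Rmult_comm. apply Un_cv_scal, green_cv.
      * rewrite Rmult_comm. apply Un_cv_scal, green_cv.
Qed.

End Explorer.

(** * Attachment probabilities *)

Lemma bsum_window_widen (F : Z -> R) (a b : Z) (n m : nat) :
  (b <= a)%Z -> (a + Z.of_nat n <= b + Z.of_nat m)%Z ->
  (forall z, (z < a \/ a + Z.of_nat n <= z)%Z -> F z = 0) ->
  bsum m (fun k => F (b + Z.of_nat k)%Z) = bsum n (fun k => F (a + Z.of_nat k)%Z).
Proof.
  intros H1 H2 HF.
  replace m with (Z.to_nat (a - b) + (n + (m - n - Z.to_nat (a - b))))%nat by lia.
  rewrite !bsum_split, (bsum_0 (Z.to_nat (a - b))), (bsum_0 (m - n - Z.to_nat (a - b))).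
  - rewrite Rplus_0_l, Rplus_0_r. apply bsum_ext. intros i Hi. f_equal. lia.
  - intros i Hi. apply HF. lia.
  - intros i Hi. apply HF. lia.
Qed.

(** Both windows are compared with their common hull. This turns the window of [hit_term], placed
    around the starting height, into the heights [0] to [c i]. *)
Lemma bsum_window_eq (F : Z -> R) (a b : Z) (n m : nat) :
  (forall z, (z < a \/ a + Z.of_nat n <= z)%Z -> F z = 0) ->
  (forall z, (z < b \/ b + Z.of_nat m <= z)%Z -> F z = 0) ->
  bsum n (fun k => F (a + Z.of_nat k)%Z) = bsum m (fun k => F (b + Z.of_nat k)%Z).
Proof.
  intros Ha Hb.
  set (l := Z.min a b).
  set (L := Z.to_nat (Z.max (a + Z.of_nat n) (b + Z.of_nat m) - l)).
  rewrite <- (bsum_window_widen F a l n L) by (exact Ha || lia).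
  apply bsum_window_widen; exact Hb || lia.
Qed.

(** A column of height [h] contributes [h (h + 1)], the sum of [visit_bound] over its sites above
    the ground. *)
Definition energy (N : nat) (c : config) : R :=
  bsum N (fun i => INR (c i) * INR (S (c i))).

(* At low energy this is, up to a factor between [1/2] and [1], [N] times the
   probability that a column of height [h] grows. *)
Definition rate (h : nat) : R := 1 + INR h * INR (S h).

Lemma rate_ge_1 h : 1 <= rate h.
Proof. unfold rate. assert (A := pos_INR h). assert (B := pos_INR (S h)). nra. Qed.

Lemma sum_twice_height h (m : nat) :
  (h <= m)%nat ->
  bsum (S m) (fun z => 2 * INR z * (if Nat.leb z h then 1 else 0)) = INR h * INR (S h).
Proof.
  intros Hm. rewrite (bsum_trunc (S h)); [|lia|].
  - rewrite (bsum_ext _ _ (fun z => 2 * INR z)).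
    + clear Hm. induction h as [|h IH]; [simpl; lra|]. cbn [bsum] in *. rewrite IH, !S_INR. ring.
    + intros i Hi. destruct (Nat.leb_spec i h); [ring|lia].
  - intros i Hi. destruct (Nat.leb_spec i h); [lia|ring].
Qed.

Section Kernel.

Variables (N : nat) (c : config).
Hypothesis N_pos : (0 < N)%nat.

Let H := maxh N c.
Let s z := survive N c (Z.of_nat z).

Lemma hit_term_eq i n :
  hit_term N c i n = / INR N * bsum (S (c i)) (fun z => fsurv N c n (Z.of_nat z)).
Proof.
  set (F z := fsurv N c n z * (if Z.leb z (Z.of_nat (c i)) then 1 else 0) / INR N).
  unfold hit_term. rewrite sum_f_R0_bsum.
  transitivity (bsum (S (2 * n)) (fun k => F ((Z.of_nat H + 1 - Z.of_nat n) + Z.of_nat k)%Z)).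
  { reflexivity. }
  rewrite (bsum_window_eq F _ 0 (S (2 * n)) (S (c i))).
  - rewrite <- bsum_scal. apply bsum_ext. intros z Hz. unfold F. rewrite Z.add_0_l.
    destruct (Z.leb_spec (Z.of_nat z) (Z.of_nat (c i))); [unfold Rdiv; ring|lia].
  - intros z Hz. unfold F. rewrite fsurv_far by (fold H; lia). unfold Rdiv; ring.
  - intros z Hz. unfold F. destruct (Z.leb_spec z (Z.of_nat (c i))).
    + rewrite fsurv_neg by lia. unfold Rdiv; ring.
    + unfold Rdiv; ring.
Qed.

(** Exchange of the sums over time and height. By [green_cv] the series in [K] converges, so
    [epsilon] returns its sum and not an arbitrary value. *)
Lemma K_eq i : K N c i = / INR N * bsum (S (c i)) (green N c).
Proof.
  assert (L : infinite_sum (hit_term N c i) (/ INR N * bsum (S (c i)) (green N c))).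
  { change (Un_cv (sum_f_R0 (hit_term N c i)) (/ INR N * bsum (S (c i)) (green N c))).
    apply (Un_cv_ext (fun M => / INR N * bsum (S (c i))
             (fun z => bsum (S M) (fun n => fsurv N c n (Z.of_nat z))))).
    - intros M. rewrite sum_f_R0_bsum, (bsum_ext _ _ _ (fun n _ => hit_term_eq i n)), bsum_scal.
      f_equal. apply bsum_swap.
    - apply Un_cv_scal.
      apply (Un_cv_bsum _ (fun z M => bsum (S M) (fun n => fsurv N c n (Z.of_nat z)))).
      intros z. apply (Un_cv_shift (fun M => bsum M (fun n => fsurv N c n (Z.of_nat z)))).
      now apply green_cv. }
  apply (uniqueness_sum (hit_term N c i)); [|exact L].
  unfold K. apply epsilon_spec. now exists (/ INR N * bsum (S (c i)) (green N c)).
Qed.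

Lemma K_nonneg i : 0 <= K N c i.
Proof.
  rewrite K_eq. apply Rmult_le_pos.
  - apply Rlt_le, Rinv_0_lt_compat, INR_N_pos, N_pos.
  - apply bsum_nonneg. intros. now apply green_nonneg.
Qed.

(** After exchanging sums, level [z] is counted once per column of height at least [z], that is
    [N (1 - s z)] times; what remains is [green_killed_total]. *)
Lemma K_total : bsum N (fun i => K N c i) = 1.
Proof.
  rewrite <- (green_killed_total N c N_pos).
  rewrite (bsum_ext N (fun i => K N c i) (fun i => bsum (S H)
     (fun z => / INR N * green N c z * (if Nat.leb z (c i) then 1 else 0)))).
  - rewrite bsum_swap. apply bsum_ext. intros z _. rewrite survive_killed by exact N_pos.
    rewrite bsum_scal. ring.
  - intros i Hi. rewrite K_eq.
    rewrite (bsum_trunc (S (c i)) (S H)).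
    + rewrite <- bsum_scal. apply bsum_ext. intros z Hz.
      destruct (Nat.leb_spec z (c i)); [ring|lia].
    + assert (X := maxh_ge N c i Hi). fold H in X. lia.
    + intros z Hz. destruct (Nat.leb_spec z (c i)); [lia|ring].
Qed.

(** The values of [visit_bound] from [0] to [h] add up to [rate h]. *)
Lemma K_upper i : K N c i <= rate (c i) / INR N.
Proof.
  rewrite K_eq. unfold Rdiv. rewrite (Rmult_comm (rate _)). apply Rmult_le_compat_l.
  - apply Rlt_le, Rinv_0_lt_compat, INR_N_pos, N_pos.
  - apply Rle_trans with (bsum (S (c i)) visit_bound).
    + apply bsum_le. intros. now apply green_le.
    + unfold rate. induction (c i) as [|h IH]; [simpl; lra|].
      cbn [bsum] in *. unfold visit_bound at 3. rewrite !S_INR in *. lra.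
Qed.

(* The mass absorbed above the ground is at most [energy / N], as the expected
   number of visits at height [z] is at most [2 z]. *)
Lemma green_ground : energy N c <= INR N / 2 -> / 2 <= green N c 0.
Proof.
  intros HE. assert (HN := INR_N_pos N N_pos).
  assert (T := green_killed_total N c N_pos). fold H in T.
  rewrite bsum_S_first in T.
  rewrite survive_nonpos in T by (simpl; lia).
  enough (bsum H (fun z => green N c (S z) * (1 - s (S z))) <= / 2) by (unfold s in *; lra).
  apply Rle_trans with (/ INR N * energy N c).
  - unfold energy.
    rewrite (bsum_ext N _ (fun i => bsum (S H)
        (fun z => 2 * INR z * (if Nat.leb z (c i) then 1 else 0)))).
    2:{ intros i Hi. rewrite sum_twice_height; [reflexivity|]. now apply maxh_ge. }
    rewrite bsum_swap, bsum_S_first, (bsum_0 N) by (intros; simpl; ring).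
    rewrite Rplus_0_l, <- bsum_scal. apply bsum_le. intros z _.
    unfold s. rewrite survive_killed, bsum_scal by exact N_pos.
    assert (G := green_le N c N_pos (S z)). unfold visit_bound in G.
    assert (P : 0 <= / INR N * bsum N (fun i => if Nat.leb (S z) (c i) then 1 else 0)).
    { apply Rmult_le_pos; [now apply Rlt_le, Rinv_0_lt_compat|].
      apply bsum_nonneg. intros i _. destruct (Nat.leb _ _); lra. }
    replace (/ INR N * (2 * INR (S z) * bsum N (fun i => if Nat.leb (S z) (c i) then 1 else 0)))
      with (2 * INR (S z) * (/ INR N * bsum N (fun i => if Nat.leb (S z) (c i) then 1 else 0)))
      by ring.
    now apply Rmult_le_compat_r.
  - apply Rmult_le_reg_l with (INR N); [exact HN|].
    rewrite <- Rmult_assoc, Rinv_r, Rmult_1_l by lra. lra.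
Qed.

(* [green * survive] is convex up to height [H], vanishes at [0], and has slope at
   least [1] there. *)
Lemma green_ge z : energy N c <= INR N / 2 -> (z <= H)%nat -> INR z <= green N c z.
Proof.
  intros HE. assert (G0 := green_ground HE).
  set (u z := green N c z * s z).
  assert (u0 : u 0%nat = 0).
  { unfold u, s. rewrite survive_nonpos by (simpl; lia). ring. }
  assert (Eq : forall z, (z <= H)%nat ->
      green N c z = / 2 * (match z with O => 0 | S y => u y end + u (S z))).
  { intros y Hy. exact (green_eq N c N_pos y Hy). }
  assert (u_le : forall z, u z <= green N c z).
  { intros y. assert (X := survive_bounds N c N_pos (Z.of_nat y)). fold (s y) in X.
    assert (Y := green_nonneg N c N_pos y). unfold u. nra. }
  (* Base: [u 1 = 2 green 0 >= 1]. Step: [green_eq] gives [u y + u (y + 2) = 2 green (y + 1) >= 2 u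
     (y + 1)], so slopes do not decrease. *)
  assert (slope : forall y, (y <= H)%nat -> 1 <= u (S y) - u y).
  { induction y as [|y IH]; intros Hy.
    - specialize (Eq 0%nat Hy). cbn in Eq. lra.
    - specialize (IH ltac:(lia)). specialize (Eq (S y) Hy). cbn in Eq.
      specialize (u_le (S y)). lra. }
  assert (lin : forall y, (y <= S H)%nat -> INR y <= u y).
  { induction y as [|y IH]; intros Hy; [simpl; lra|].
    specialize (IH ltac:(lia)). specialize (slope y ltac:(lia)). rewrite S_INR. lra. }
  intros Hz. rewrite Eq by exact Hz. destruct z as [|y].
  - simpl. specialize (lin 1%nat ltac:(lia)). simpl in lin. lra.
  - assert (A := lin y ltac:(lia)). assert (B := lin (S (S y)) ltac:(lia)).
    rewrite !S_INR in *. lra.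
Qed.

(** Adding [green 0 >= 1/2] and [green z >= z] for [1 <= z <= h] gives half of [rate h]. *)
Lemma K_lower i :
  (i < N)%nat -> energy N c <= INR N / 2 -> rate (c i) / (2 * INR N) <= K N c i.
Proof.
  intros Hi HE. rewrite K_eq.
  assert (HN := INR_N_pos N N_pos).
  replace (rate (c i) / (2 * INR N)) with (/ INR N * (rate (c i) / 2)) by (field; lra).
  apply Rmult_le_compat_l; [now apply Rlt_le, Rinv_0_lt_compat|].
  assert (G : forall h, (h <= H)%nat -> rate h / 2 <= bsum (S h) (green N c)).
  { induction h as [|h IH]; intros Hh.
    - unfold rate. simpl. assert (A := green_ground HE). lra.
    - specialize (IH ltac:(lia)). assert (A := green_ge (S h) HE Hh).
      cbn [bsum] in *. unfold rate in *. rewrite !S_INR in *. lra. }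
  apply G. now apply maxh_ge.
Qed.

End Kernel.

(** * Exponential supermartingales *)

Section Expectation.

Variable N : nat.
Hypothesis N_pos : (0 < N)%nat.

Definition total (c : config) : R := bsum N (fun i => INR (c i)).

Lemma total_incr c i : (i < N)%nat -> total (incr c i) = total c + 1.
Proof. intros Hi. unfold total. rewrite bsum_incr by exact Hi. rewrite S_INR. ring. Qed.

Lemma Ev_S t F c : Ev N (S t) F c = bsum N (fun i => K N c i * Ev N t F (incr c i)).
Proof.
  cbn [Ev]. rewrite sum_f_R0_bsum. now replace (S (N - 1)) with N by lia.
Qed.

(** Each explorer raises [total] by one. The restriction lets a comparison use the number of
    particles deposited. *)
Lemma Ev_le_reachable t F G c :
  (forall d, total d = total c + INR t -> F d <= G d) -> Ev N t F c <= Ev N t G c.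
Proof.
  revert c. induction t as [|t IH]; intros c HFG.
  - apply HFG. simpl. ring.
  - rewrite !Ev_S. apply bsum_le. intros i Hi. apply Rmult_le_compat_l; [now apply K_nonneg|].
    apply IH. intros d Hd. apply HFG. rewrite Hd, total_incr, S_INR by exact Hi. ring.
Qed.

Lemma Ev_le t F G c : (forall d, F d <= G d) -> Ev N t F c <= Ev N t G c.
Proof. intros H. apply Ev_le_reachable. intros; apply H. Qed.

Lemma Ev_const t a c : Ev N t (fun _ => a) c = a.
Proof.
  revert c. induction t as [|t IH]; intros c; [reflexivity|]. rewrite Ev_S.
  rewrite (bsum_ext _ _ (fun i => a * K N c i)).
  - rewrite bsum_scal, K_total by exact N_pos. ring.
  - intros i _. rewrite IH. ring.
Qed.

Lemma Ev_scal t a F c : Ev N t (fun d => a * F d) c = a * Ev N t F c.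
Proof.
  revert c. induction t as [|t IH]; intros c; [reflexivity|]. rewrite !Ev_S, <- bsum_scal.
  apply bsum_ext. intros i _. rewrite IH. ring.
Qed.

Lemma Ev_plus t F G c : Ev N t (fun d => F d + G d) c = Ev N t F c + Ev N t G c.
Proof.
  revert c. induction t as [|t IH]; intros c; [reflexivity|]. rewrite !Ev_S, <- bsum_plus.
  apply bsum_ext. intros i _. rewrite IH. ring.
Qed.

Lemma Ev_compose t u F c : Ev N t (fun d => Ev N u F d) c = Ev N (t + u) F c.
Proof.
  revert c. induction t as [|t IH]; intros c; [reflexivity|].
  change (S t + u)%nat with (S (t + u)). rewrite !Ev_S.
  apply bsum_ext. intros i _. now rewrite IH.
Qed.

Lemma energy_incr c i : (i < N)%nat -> energy N c <= energy N (incr c i).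
Proof.
  intros Hi. unfold energy. rewrite (bsum_incr N c i (fun h => INR h * INR (S h)) Hi).
  rewrite !S_INR. assert (A := pos_INR (c i)). nra.
Qed.

(** Energy never decreases, so the low-energy indicator stays zero once it has vanished. *)
Lemma Ev_energy_exceeded t c :
  INR N / 2 < energy N c ->
  Ev N t (fun d => Defs.ind _ (Rle_dec (energy N d) (INR N / 2))) c = 0.
Proof.
  revert c. induction t as [|t IH]; intros c Hc.
  - simpl. unfold Defs.ind. destruct (Rle_dec _ _); [lra|reflexivity].
  - rewrite Ev_S. apply bsum_0. intros i Hi. rewrite IH; [ring|].
    assert (A := energy_incr c i Hi). lra.
Qed.

(** From [exp (- x) >= 1 - x], so that [exp x <= 1 / (1 - x)]. *)
Lemma exp_le_affine x : 0 <= x <= / 2 -> exp x <= 1 + 2 * x.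
Proof.
  intros Hx. assert (A := exp_ineq1_le (- x)). rewrite exp_Ropp in A.
  assert (B := exp_pos x).
  assert (C : (1 - x) * exp x <= 1).
  { apply Rle_trans with (/ exp x * exp x); [|right; field; lra].
    apply Rmult_le_compat_r; lra. }
  nra.
Qed.

Lemma exp_opp_le_affine x : 0 <= x <= 1 -> exp (- x) <= 1 - x / 2.
Proof.
  intros Hx. assert (A := exp_ineq1_le x). rewrite exp_Ropp.
  assert (B := exp_pos x).
  apply Rmult_le_reg_l with (exp x); [exact B|]. rewrite Rinv_r by lra. nra.
Qed.

(* One explorer changes one column only, so columns contribute additively to the
   exponent, as if they were independent. *)
Lemma step_upper (psi : nat -> R) c :
  (forall h, 0 <= psi (S h) - psi h <= / 2) ->
  bsum N (fun i => K N c i * exp (bsum N (fun j => psi (incr c i j))))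
  <= exp (bsum N (fun i => psi (c i) + 2 / INR N * (rate (c i) * (psi (S (c i)) - psi (c i))))).
Proof.
  intros Hpsi. assert (HN := INR_N_pos N N_pos).
  set (A := bsum N (fun j => psi (c j))).
  set (B := bsum N (fun i => rate (c i) * (psi (S (c i)) - psi (c i)))).
  rewrite bsum_plus, bsum_scal. fold A B. rewrite exp_plus.
  apply Rle_trans with (exp A * bsum N (fun i => K N c i
         + 2 / INR N * (rate (c i) * (psi (S (c i)) - psi (c i))))).
  - rewrite <- bsum_scal. apply bsum_le. intros i Hi. rewrite bsum_incr by exact Hi.
    fold A. rewrite exp_plus. specialize (Hpsi (c i)).
    set (D := psi (S (c i)) - psi (c i)) in *.
    assert (X := exp_le_affine D Hpsi). assert (P := exp_pos A).
    assert (KU := K_upper N c N_pos i). assert (K0 := K_nonneg N c N_pos i).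
    replace (2 / INR N * (rate (c i) * D)) with (rate (c i) / INR N * (2 * D)) by (field; lra).
    replace (K N c i * (exp A * exp D)) with (exp A * (K N c i * exp D)) by ring.
    apply Rmult_le_compat_l; [lra|]. nra.
  - apply Rmult_le_compat_l; [left; apply exp_pos|].
    rewrite bsum_plus, bsum_scal, K_total by exact N_pos. fold B. apply exp_ineq1_le.
Qed.

(** Counterpart of [step_upper] based on [K_lower], hence the low energy. The [4] combines the [2]
    of [K_lower] with the [2] of [exp_opp_le_affine]. *)
Lemma step_lower (psi : nat -> R) c :
  (forall h, 0 <= psi (S h) - psi h <= 1) ->
  energy N c <= INR N / 2 ->
  bsum N (fun i => K N c i * exp (- bsum N (fun j => psi (incr c i j))))
  <= exp (- bsum N (fun i => psi (c i)
             + / (4 * INR N) * (rate (c i) * (psi (S (c i)) - psi (c i))))).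
Proof.
  intros Hpsi HE. assert (HN := INR_N_pos N N_pos).
  set (A := bsum N (fun j => psi (c j))).
  set (B := bsum N (fun i => rate (c i) * (psi (S (c i)) - psi (c i)))).
  rewrite bsum_plus, bsum_scal. fold A B. rewrite Ropp_plus_distr, exp_plus.
  apply Rle_trans with (exp (- A) * bsum N (fun i => K N c i
         - / (4 * INR N) * (rate (c i) * (psi (S (c i)) - psi (c i))))).
  - rewrite <- bsum_scal. apply bsum_le. intros i Hi. rewrite bsum_incr by exact Hi.
    fold A. rewrite Ropp_plus_distr, exp_plus. specialize (Hpsi (c i)).
    set (D := psi (S (c i)) - psi (c i)) in *.
    assert (X := exp_opp_le_affine D Hpsi). assert (P := exp_pos (- A)).
    assert (KL := K_lower N c N_pos i Hi HE). assert (K0 := K_nonneg N c N_pos i).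
    replace (/ (4 * INR N) * (rate (c i) * D)) with (rate (c i) / (2 * INR N) * (D / 2))
      by (field; lra).
    replace (K N c i * (exp (- A) * exp (- D))) with (exp (- A) * (K N c i * exp (- D))) by ring.
    apply Rmult_le_compat_l; [lra|]. nra.
  - apply Rmult_le_compat_l; [left; apply exp_pos|].
    rewrite bsum_minus, bsum_scal, K_total by exact N_pos. fold B.
    assert (X := exp_ineq1_le (- (/ (4 * INR N) * B))). lra.
Qed.

End Expectation.

(** * Eigenfunction of the growth rates *)

(* Chosen so that [profile] is an eigenfunction of [h |-> rate h * (f (h + 1) - f h)]. *)
Fixpoint profile (kappa : R) (h : nat) : R :=
  match h with O => 1 | S h' => profile kappa h' * (1 + kappa / rate h') end.

Section Profile.

Variable kappa : R.
Hypothesis kappa_nonneg : 0 <= kappa.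

Lemma profile_factor h : 1 <= 1 + kappa / rate h.
Proof.
  assert (A := rate_ge_1 h).
  assert (0 <= kappa / rate h) by (apply Rle_mult_inv_pos; lra). lra.
Qed.

Lemma profile_ge_1 h : 1 <= profile kappa h.
Proof.
  induction h as [|h IH]; simpl; [lra|]. assert (A := profile_factor h). nra.
Qed.

Lemma profile_incr h h' : (h <= h')%nat -> profile kappa h <= profile kappa h'.
Proof.
  induction 1 as [|h' _ IH]; [lra|]. simpl.
  assert (A := profile_factor h'). assert (B := profile_ge_1 h'). nra.
Qed.

Lemma profile_eq h :
  rate h * (profile kappa (S h) - profile kappa h) = kappa * profile kappa h.
Proof. assert (A := rate_ge_1 h). simpl. field. lra. Qed.

Lemma rate_incr h h' : (h <= h')%nat -> rate h <= rate h'.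
Proof.
  intros Hh. unfold rate. assert (A := le_INR _ _ Hh). assert (B := pos_INR h).
  rewrite !S_INR. nra.
Qed.

(** [rate] is nondecreasing, so every factor up to height [k] is at least [1 + kappa / rate k]. With
    [kappa] of order [k ^ 2] this makes the profile at [k] exponentially large in [k]. *)
Lemma profile_lower k h : (h <= k)%nat -> (1 + kappa / rate k) ^ h <= profile kappa h.
Proof.
  induction h as [|h IH]; intros Hh; simpl; [lra|].
  assert (A := rate_ge_1 h). assert (B := rate_incr h k ltac:(lia)).
  rewrite Rmult_comm. apply Rmult_le_compat.
  - apply pow_le. assert (X := profile_factor k). lra.
  - assert (X := profile_factor k). lra.
  - apply IH. lia.
  - apply Rplus_le_compat_l. unfold Rdiv. apply Rmult_le_compat_l; [lra|].
    apply Rinv_le_contravar; lra.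
Qed.

End Profile.

Definition profile_sum (N : nat) (kappa : R) (c : config) : R :=
  bsum N (fun i => profile kappa (c i)).

Section Growth.

Variables (N : nat) (kappa P : R).
Hypothesis N_pos : (0 < N)%nat.
Hypothesis kappa_nonneg : 0 <= kappa.
Hypothesis profile_le : forall h, profile kappa h <= P.


Lemma profile_increment_le a h b :
  0 <= a -> a * P <= b -> 0 <= a * profile kappa (S h) - a * profile kappa h <= b.
Proof.
  intros Ha HaP. assert (A := profile_incr kappa kappa_nonneg h (S h) ltac:(lia)).
  assert (B := profile_ge_1 kappa kappa_nonneg h). assert (D := profile_le (S h)). split; nra.
Qed.

(** Induction on the number of explorers left: [step_upper] is applied to [C r ^ t] times the
    profile, and [profile_eq] turns its drift into one more factor [r]. The bound on [C r ^ t P]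
    keeps the increments of the exponent at most [1/2]. *)
Lemma growth_upper C t c :
  0 <= C -> C * (1 + 2 * kappa / INR N) ^ t * P <= / 2 ->
  Ev N t (fun d => exp (C * profile_sum N kappa d)) c
  <= exp (C * (1 + 2 * kappa / INR N) ^ t * profile_sum N kappa c).
Proof.
  intros HC. assert (HN := INR_N_pos N N_pos).
  assert (P1 : 1 <= P) by (assert (X := profile_le 0); simpl in X; lra).
  assert (Hr : 1 <= 1 + 2 * kappa / INR N).
  { assert (0 <= 2 * kappa / INR N) by (apply Rle_mult_inv_pos; lra). lra. }
  set (r := 1 + 2 * kappa / INR N) in *.
  revert c. induction t as [|t IH]; intros c Hb.
  - simpl. right. f_equal. ring.
  - rewrite Ev_S by exact N_pos.
    assert (Hrt : 0 <= C * r ^ t).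
    { assert (X := pow_lt r t ltac:(lra)). nra. }
    assert (Hb' : C * r ^ t * P <= / 2).
    { simpl in Hb. assert (0 <= C * r ^ t * P) by (apply Rmult_le_pos; lra).
      replace (C * (r * r ^ t) * P) with (r * (C * r ^ t * P)) in Hb by ring. nra. }
    apply Rle_trans with (bsum N (fun i => K N c i *
         exp (bsum N (fun j => C * r ^ t * profile kappa (incr c i j))))).
    { apply bsum_le. intros i Hi. apply Rmult_le_compat_l; [now apply K_nonneg|].
      rewrite bsum_scal. apply IH, Hb'. }
    eapply Rle_trans.
    { apply (step_upper N N_pos (fun h => C * r ^ t * profile kappa h)).
      intros h. apply profile_increment_le; [exact Hrt|exact Hb']. }
    right. f_equal. unfold profile_sum. rewrite <- bsum_scal. apply bsum_ext. intros i _.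
    rewrite <- Rmult_minus_distr_l.
    replace (rate (c i) * (C * r ^ t * (profile kappa (S (c i)) - profile kappa (c i))))
      with (C * r ^ t * (rate (c i) * (profile kappa (S (c i)) - profile kappa (c i)))) by ring.
    rewrite profile_eq. simpl. unfold r. field. lra.
Qed.

(** The same induction with a negative exponent, stopped at high energy, where [Ev_energy_exceeded]
    makes the left side zero. The offset [N P] bounds the profile sum, so the right side is at least
    [1] when no explorer is left. *)
Lemma growth_lower C t c :
  0 <= C -> C * (1 + kappa / (4 * INR N)) ^ t * P <= 1 ->
  Ev N t (fun d => Defs.ind _ (Rle_dec (energy N d) (INR N / 2))) c
  <= exp (- (C * ((1 + kappa / (4 * INR N)) ^ t * profile_sum N kappa c - INR N * P))).
Proof.
  intros HC. assert (HN := INR_N_pos N N_pos).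
  assert (P1 : 1 <= P) by (assert (X := profile_le 0); simpl in X; lra).
  assert (Hr : 1 <= 1 + kappa / (4 * INR N)).
  { assert (0 <= kappa / (4 * INR N)) by (apply Rle_mult_inv_pos; lra). lra. }
  set (r := 1 + kappa / (4 * INR N)) in *.
  revert c. induction t as [|t IH]; intros c Hb.
  - simpl. apply Rle_trans with 1.
    { unfold Defs.ind. destruct (Rle_dec _ _); lra. }
    assert (profile_sum N kappa c <= INR N * P).
    { unfold profile_sum. rewrite <- bsum_const. apply bsum_le. intros; apply profile_le. }
    rewrite <- exp_0 at 1.
    assert (X : 0 <= - (C * (1 * profile_sum N kappa c - INR N * P))) by nra.
    destruct X as [X|X]; [left; now apply exp_increasing|rewrite <- X; lra].
  - destruct (Rle_dec (energy N c) (INR N / 2)) as [HE|HE].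
    2:{ rewrite Ev_energy_exceeded by (exact N_pos || lra). left. apply exp_pos. }
    rewrite Ev_S by exact N_pos.
    assert (Hrt : 0 <= C * r ^ t).
    { assert (X := pow_lt r t ltac:(lra)). nra. }
    assert (Hb' : C * r ^ t * P <= 1).
    { simpl in Hb. assert (0 <= C * r ^ t * P) by (apply Rmult_le_pos; lra).
      replace (C * (r * r ^ t) * P) with (r * (C * r ^ t * P)) in Hb by ring. nra. }
    apply Rle_trans with (exp (C * INR N * P) * bsum N (fun i => K N c i *
         exp (- bsum N (fun j => C * r ^ t * profile kappa (incr c i j))))).
    { rewrite <- bsum_scal. apply bsum_le. intros i Hi.
      eapply Rle_trans; [apply Rmult_le_compat_l; [now apply K_nonneg|apply IH, Hb']|].
      right. rewrite bsum_scal. fold (profile_sum N kappa (incr c i)).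
      replace (- (C * (r ^ t * profile_sum N kappa (incr c i) - INR N * P)))
        with (C * INR N * P + - (C * r ^ t * profile_sum N kappa (incr c i))) by ring.
      rewrite exp_plus. ring. }
    eapply Rle_trans.
    { apply Rmult_le_compat_l; [left; apply exp_pos|].
      apply (step_lower N N_pos (fun h => C * r ^ t * profile kappa h)); [|exact HE].
      intros h. apply profile_increment_le; [exact Hrt|exact Hb']. }
    right. rewrite <- exp_plus. f_equal.
    rewrite (bsum_ext N _ (fun i => C * r ^ S t * profile kappa (c i))).
    + rewrite bsum_scal. fold (profile_sum N kappa c). ring.
    + intros i _. rewrite <- Rmult_minus_distr_l.
      replace (rate (c i) * (C * r ^ t * (profile kappa (S (c i)) - profile kappa (c i))))
        with (C * r ^ t * (rate (c i) * (profile kappa (S (c i)) - profile kappa (c i)))) by ring.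
      rewrite profile_eq. simpl. unfold r. field. lra.
Qed.

End Growth.

(** * Quantitative bounds *)

Lemma exp_le x y : x <= y -> exp x <= exp y.
Proof. intros [H| ->]; [left; now apply exp_increasing|lra]. Qed.

Lemma exp_pow x n : exp x ^ n = exp (INR n * x).
Proof.
  induction n as [|n IH]; [simpl; now rewrite Rmult_0_l, exp_0|].
  rewrite S_INR. simpl pow. rewrite IH, <- exp_plus. f_equal. ring.
Qed.

Lemma pow_one_plus_le x n : 0 <= x -> (1 + x) ^ n <= exp (INR n * x).
Proof.
  intros Hx. rewrite <- exp_pow. apply pow_incr. split; [lra|apply exp_ineq1_le].
Qed.

Lemma exp_1_ge_2 : 2 <= exp 1.
Proof. assert (A := exp_ineq1_le 1). lra. Qed.

Lemma pow_le_exp_fact x n : 0 <= x -> x ^ n <= exp x * INR (fact n).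
Proof.
  intros Hx. assert (A := ElemFct.exp_ge_taylor x n Hx). rewrite sum_f_R0_bsum in A.
  assert (B : x ^ n / INR (fact n) <= bsum (S n) (fun k => x ^ k / INR (fact k))).
  { apply (bsum_single (S n) (fun k => x ^ k / INR (fact k))); [lia|]. intros j _.
    apply Rle_mult_inv_pos; [now apply pow_le|apply INR_fact_lt_0]. }
  assert (F := INR_fact_lt_0 n).
  apply Rle_trans with (x ^ n / INR (fact n) * INR (fact n)); [right; field; lra|].
  apply Rmult_le_compat_r; lra.
Qed.

(** * Uniform bound on the profile *)

Section ProfileBound.

Variable m : nat.
Hypothesis m_pos : (0 < m)%nat.

Let kappa := INR m ^ 2.

Lemma sqr_INR_nonneg : 0 <= kappa.
Proof. apply pow2_ge_0. Qed.

Lemma m_ge_1 : 1 <= INR m.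
Proof. change 1 with (INR 1). now apply le_INR. Qed.

(* For [h < m] the ratio [1 + m^2 / rate h] is at most [(2 m / (h + 1))^2]. *)
Lemma profile_fact h :
  (h <= m)%nat -> INR (fact h) ^ 2 * profile kappa h <= ((2 * INR m) ^ h) ^ 2.
Proof.
  assert (M := m_ge_1).
  induction h as [|h IH]; intros Hh; [simpl; lra|]. specialize (IH ltac:(lia)).
  change (fact (S h)) with (S h * fact h)%nat. rewrite mult_INR. cbn [profile].
  assert (R1 := rate_ge_1 h). assert (Q := pos_INR h). assert (Hm := le_INR _ _ Hh).
  replace ((INR (S h) * INR (fact h)) ^ 2 * (profile kappa h * (1 + kappa / rate h)))
    with ((INR (fact h) ^ 2 * profile kappa h) * (INR (S h) ^ 2 * (1 + kappa / rate h))) by ring.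
  replace (((2 * INR m) ^ S h) ^ 2) with (((2 * INR m) ^ h) ^ 2 * (4 * INR m ^ 2)) by (simpl; ring).
  assert (X := profile_factor kappa sqr_INR_nonneg h).
  assert (Y := profile_ge_1 kappa sqr_INR_nonneg h).
  apply Rmult_le_compat; [| |exact IH|].
  - apply Rmult_le_pos; [apply pow2_ge_0|lra].
  - apply Rmult_le_pos; [apply pow2_ge_0|lra].
  - assert (D : INR (S h) ^ 2 <= 2 * rate h) by (unfold rate; rewrite !S_INR; nra).
    assert (E : INR (S h) ^ 2 * (kappa / rate h) <= 2 * kappa).
    { apply Rle_trans with (2 * rate h * (kappa / rate h)); [|right; field; lra].
      apply Rmult_le_compat_r; lra. }
    assert (F : INR (S h) ^ 2 <= INR m ^ 2) by (apply pow_incr; split; [apply pos_INR|exact Hm]).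
    unfold kappa in *. nra.
Qed.

(** [profile_fact] at [h = m], combined with the square of [(2 m) ^ m <= exp (2 m) m!]. *)
Lemma profile_head : profile kappa m <= exp (4 * INR m).
Proof.
  assert (M := m_ge_1).
  assert (A := profile_fact m (le_n m)).
  assert (B := pow_le_exp_fact (2 * INR m) m ltac:(lra)).
  assert (F := INR_fact_lt_0 m).
  assert (D : ((2 * INR m) ^ m) ^ 2 <= (exp (2 * INR m) * INR (fact m)) ^ 2).
  { apply pow_incr. split; [apply pow_le; lra|exact B]. }
  replace (exp (4 * INR m)) with (exp (2 * INR m) ^ 2)
    by (rewrite exp_pow; f_equal; simpl; ring).
  apply Rmult_le_reg_l with (INR (fact m) ^ 2); [apply pow_lt; lra|]. nra.
Qed.

(* [1 / rate h <= 1 / h - 1 / (h + 1)] *)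
Lemma profile_tail j :
  profile kappa (m + j) <= exp (4 * INR m + kappa * (/ INR m - / INR (m + j))).
Proof.
  assert (M := m_ge_1).
  induction j as [|j IH].
  - rewrite Nat.add_0_r. eapply Rle_trans; [apply profile_head|]. right. f_equal. ring.
  - rewrite Nat.add_succ_r. cbn [profile].
    set (h := (m + j)%nat) in *.
    assert (Hh : INR m <= INR h) by (apply le_INR; unfold h; lia).
    assert (R1 := rate_ge_1 h).
    assert (Y := profile_ge_1 kappa sqr_INR_nonneg h).
    assert (X := profile_factor kappa sqr_INR_nonneg h).
    assert (D : kappa / rate h <= kappa * (/ INR h - / INR (S h))).
    { unfold Rdiv. apply Rmult_le_compat_l; [apply sqr_INR_nonneg|].
      replace (/ INR h - / INR (S h)) with (/ (INR h * INR (S h)))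
        by (rewrite S_INR; field; lra).
      apply Rinv_le_contravar; unfold rate; rewrite !S_INR; nra. }
    replace (4 * INR m + kappa * (/ INR m - / INR (S h))) with
      (4 * INR m + kappa * (/ INR m - / INR h) + kappa * (/ INR h - / INR (S h))) by ring.
    rewrite exp_plus. apply Rmult_le_compat; [lra|lra|exact IH|].
    eapply Rle_trans; [apply exp_ineq1_le|]. now apply exp_le.
Qed.

(** The first [m] factors account for [exp (4 m)]; the telescoping tail adds at most [m ^ 2 / m = m]
    to the exponent. *)
Lemma profile_le_exp h : profile kappa h <= exp (5 * INR m).
Proof.
  assert (M := m_ge_1).
  apply Rle_trans with (profile kappa (m + h)).
  { apply profile_incr; [apply sqr_INR_nonneg|lia]. }
  eapply Rle_trans; [apply profile_tail|]. apply exp_le.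
  assert (A : 0 <= / INR (m + h)).
  { apply Rlt_le, Rinv_0_lt_compat, lt_0_INR. lia. }
  assert (B : kappa * / INR m = INR m) by (unfold kappa; field; lra).
  assert (0 <= kappa * / INR (m + h)) by (apply Rmult_le_pos; [apply sqr_INR_nonneg|exact A]).
  nra.
Qed.

End ProfileBound.

Lemma sum_profile_empty N kappa :
  profile_sum N kappa empty_config = INR N.
Proof. unfold profile_sum, empty_config. simpl. rewrite bsum_const. ring. Qed.

Lemma rate_drift_le N kappa b t :
  (0 < N)%nat -> 0 <= kappa -> INR t * (2 * kappa / INR N) <= b ->
  (1 + 2 * kappa / INR N) ^ t <= exp b.
Proof.
  intros HN Hk Hb. assert (X := INR_N_pos N HN).
  eapply Rle_trans; [apply pow_one_plus_le; apply Rle_mult_inv_pos; lra|]. now apply exp_le.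
Qed.

(** Markov's inequality for [exp (C S) - 1], with [S] the profile sum: this variable is at least
    [C profile k] as soon as some column reaches height [k]. For small [C] it is nearly linear in
    [S], and [C] cancels from the bound. *)
Lemma tall_column_bound N m k t b :
  (0 < N)%nat -> (0 < m)%nat -> INR t * (2 * INR m ^ 2 / INR N) <= b ->
  Ev N t (fun d => if Nat.leb k (maxh N d) then 1 else 0) empty_config
  <= 2 * INR N * exp b / profile (INR m ^ 2) k.
Proof.
  intros N_pos m_pos Hb. assert (HN := INR_N_pos N N_pos).
  set (kappa := INR m ^ 2) in *.
  assert (Hk : 0 <= kappa) by apply pow2_ge_0.
  assert (Hprof := profile_le_exp m m_pos). fold kappa in Hprof.
  set (P := exp (5 * INR m)) in *.
  set (r := (1 + 2 * kappa / INR N) ^ t).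
  assert (Hr : r <= exp b) by now apply rate_drift_le.
  assert (Hr0 : 0 < r).
  { apply pow_lt. assert (0 <= 2 * kappa / INR N) by (apply Rle_mult_inv_pos; lra). lra. }
  assert (N1 : 1 <= INR N) by (change 1 with (INR 1); now apply le_INR).
  assert (P1 : 1 <= P) by (apply Rle_trans with (2 := Hprof 0%nat); simpl; lra).
  assert (Phi1 := profile_ge_1 kappa Hk k).
  (* Small enough for [growth_upper], through [C r P <= 1/2], and for [exp_le_affine], through
     [C r N <= 1/2]. *)
  set (C := / (2 * r * P * INR N)).
  assert (X0 : 0 < 2 * r * P * INR N) by (repeat apply Rmult_lt_0_compat; lra).
  assert (HC : 0 < C) by now apply Rinv_0_lt_compat.
  assert (C1 : C * r * P <= / 2).
  { replace (C * r * P) with (/ 2 * / INR N) by (unfold C; field; repeat split; lra).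
    assert (/ INR N <= 1) by (rewrite <- Rinv_1; apply Rinv_le_contravar; lra). lra. }
  assert (C2 : C * r * INR N <= / 2).
  { replace (C * r * INR N) with (/ 2 * / P) by (unfold C; field; repeat split; lra).
    assert (/ P <= 1) by (rewrite <- Rinv_1; apply Rinv_le_contravar; lra). lra. }
  assert (G := growth_upper N kappa P N_pos Hk Hprof C t empty_config ltac:(lra) C1).
  fold r in G. rewrite sum_profile_empty in G.
  assert (CPhi : 0 < C * profile kappa k) by (apply Rmult_lt_0_compat; lra).
  apply Rle_trans with (Ev N t (fun d => / (C * profile kappa k) *
        (exp (C * profile_sum N kappa d) + - (1))) empty_config).
  - apply Ev_le; [exact N_pos|]. intros d.
    assert (S0 : 0 <= profile_sum N kappa d).
    { unfold profile_sum. apply bsum_nonneg. intros i _.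
      assert (Y := profile_ge_1 kappa Hk (d i)). lra. }
    assert (E := exp_ineq1_le (C * profile_sum N kappa d)).
    assert (I : 0 < / (C * profile kappa k)) by now apply Rinv_0_lt_compat.
    destruct (Nat.leb_spec k (maxh N d)) as [Hd|Hd].
    + destruct (maxh_attained N d N_pos) as [i [Hi Ei]].
      assert (S1 : profile kappa k <= profile_sum N kappa d).
      { apply Rle_trans with (profile kappa (d i)); [apply profile_incr; lra || lia|].
        apply (bsum_single N (fun i => profile kappa (d i))); [exact Hi|].
        intros j _. assert (Y := profile_ge_1 kappa Hk (d j)). lra. }
      apply Rle_trans with (/ (C * profile kappa k) * (C * profile kappa k)).
      { right. field. split; lra. }
      apply Rmult_le_compat_l; [lra|].
      apply (Rmult_le_compat_l C) in S1; lra.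
    + apply Rmult_le_pos; [lra|]. apply (Rmult_le_pos C) in S0; lra.
  - rewrite Ev_scal, Ev_plus, Ev_const by exact N_pos.
    assert (E := exp_le_affine (C * r * INR N)).
    assert (E0 : 0 <= C * r * INR N) by (repeat apply Rmult_le_pos; lra).
    specialize (E (conj E0 C2)).
    apply Rle_trans with (/ (C * profile kappa k) * (2 * (C * r * INR N))).
    + apply Rmult_le_compat_l; [left; now apply Rinv_0_lt_compat|]. lra.
    + replace (/ (C * profile kappa k) * (2 * (C * r * INR N)))
        with (2 * INR N * r / profile kappa k) by (field; split; lra).
      unfold Rdiv. apply Rmult_le_compat_r; [left; apply Rinv_0_lt_compat; lra|].
      apply Rmult_le_compat_l; lra.
Qed.

Lemma floorR_spec x : 0 <= x -> INR (floorR x) <= x < INR (floorR x) + 1.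
Proof.
  intros Hx. unfold floorR. destruct (base_Int_part x) as [A B].
  assert (0 <= Int_part x)%Z.
  { apply Z.lt_succ_r. apply lt_IZR. rewrite succ_IZR. lra. }
  rewrite INR_IZR_INZ, Z2Nat.id by assumption. lra.
Qed.

Lemma t_of_spec a N :
  0 <= a -> 1 <= ln (INR N) -> 0 < INR N ->
  INR (t_of a N) <= a * INR N / ln (INR N) < INR (t_of a N) + 1.
Proof.
  intros Ha Hl HN. apply floorR_spec. apply Rle_mult_inv_pos; [nra|lra].
Qed.

(** For [l >= 32], [exp (l / 2) >= (1 + l / 4) ^ 2 >= 2 l]. *)
Lemma exp_double_exp_le l : 32 <= l -> exp (- exp (l / 2)) <= exp (- (2 * l)).
Proof.
  intros Hl. apply exp_le.
  assert (A := exp_ineq1_le (l / 4)).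
  replace (l / 2) with (l / 4 + l / 4) by field. rewrite exp_plus. nra.
Qed.

(** * The three bad events for large [N] *)

Section Large.

Variable N : nat.
(** The threshold makes [l / 640000] exceed [15], which leaves room for rounding heights to
    integers. *)
Hypothesis N_large : 10 ^ 7 <= ln (INR N).
Let l := ln (INR N).

Lemma N_pos_large : (0 < N)%nat.
Proof.
  (* [ln] takes the value [0] at [0], below the threshold. *)
  destruct N as [|n]; [|lia]. exfalso. simpl INR in N_large.
  unfold ln in N_large. destruct (Rlt_dec 0 0); lra.
Qed.

Lemma N_eq_exp : INR N = exp l.
Proof. unfold l. symmetry. apply exp_ln. apply INR_N_pos, N_pos_large. Qed.

Lemma l_large : 10000000 <= l.
Proof. unfold l. lra. Qed.

(** [tall_column_bound] at [k = floor (3 l)] gives [2 N exp l / exp (2 k)], which is [exp (- 4 l)]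
    up to a constant factor. *)
Lemma early_max_bound :
  Ev N (t_of (/ 288) N) (fun d => 1 - Defs.ind _ (Rle_dec (INR (maxh N d)) (3 * l))) empty_config
  <= exp (- (2 * l)).
Proof.
  assert (L := l_large). assert (N_pos := N_pos_large). assert (HN := INR_N_pos N N_pos).
  set (k := floorR (3 * l)).
  assert (Hk : INR k <= 3 * l < INR k + 1) by (apply floorR_spec; lra).
  assert (Ht : INR (t_of (/ 288) N) <= / 288 * INR N / l).
  { apply t_of_spec; unfold l in *; lra. }
  apply Rle_trans with
    (Ev N (t_of (/ 288) N) (fun d => if Nat.leb k (maxh N d) then 1 else 0) empty_config).
  { apply Ev_le; [exact N_pos|]. intros d. unfold Defs.ind.
    destruct (Rle_dec _ _), (Nat.leb_spec k (maxh N d)) as [|H]; try lra.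
    apply lt_INR in H. lra. }
  (* With [m = 3 (k + 1)], [m ^ 2 / rate k >= 9], so the profile at [k] is at least
     [10 ^ k >= exp (2 k)]; [288 = 2 * 9 * 16] and [k + 1 <= 4 l] keep the drift at most [l]. *)
  eapply Rle_trans.
  { apply (tall_column_bound N (3 * S k) k _ l N_pos); [lia|].
    apply Rle_trans with (/ 288 * INR N / l * (2 * INR (3 * S k) ^ 2 / INR N)).
    - apply Rmult_le_compat_r; [|exact Ht].
      apply Rle_mult_inv_pos; [|exact HN]. assert (X := pow2_ge_0 (INR (3 * S k))). lra.
    - rewrite mult_INR, (S_INR k). replace (INR 3) with 3 by (simpl; ring).
      replace (/ 288 * INR N / l * (2 * (3 * (INR k + 1)) ^ 2 / INR N))
        with ((INR k + 1) ^ 2 / 16 / l) by (field; lra).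
      apply Rmult_le_reg_r with l; [lra|].
      replace ((INR k + 1) ^ 2 / 16 / l * l) with ((INR k + 1) ^ 2 / 16) by (field; lra).
      assert (X := pos_INR k).
      assert (Y : (INR k + 1) ^ 2 <= (4 * l) ^ 2) by (apply pow_incr; lra). lra. }
  assert (Pk : exp (2 * INR k) <= profile (INR (3 * S k) ^ 2) k).
  { eapply Rle_trans; [|apply profile_lower with (k := k); [apply pow2_ge_0|lia]].
    rewrite (Rmult_comm 2), <- exp_pow. apply pow_incr.
    split; [left; apply exp_pos|].
    apply Rle_trans with 10.
    - replace 2 with (1 + 1) by ring. rewrite exp_plus. assert (X := exp_le_3).
      assert (Y := exp_pos 1). nra.
    - enough (9 <= INR (3 * S k) ^ 2 / rate k) by lra.
      assert (R1 := rate_ge_1 k).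
      apply Rmult_le_reg_r with (rate k); [lra|].
      replace (INR (3 * S k) ^ 2 / rate k * rate k) with (INR (3 * S k) ^ 2) by (field; lra).
      rewrite mult_INR. unfold rate. rewrite !(S_INR k). replace (INR 3) with 3 by (simpl; ring).
      assert (X := pos_INR k). nra. }
  assert (E1 := exp_pos (2 * INR k)). assert (E2 := exp_pos l).
  rewrite N_eq_exp.
  apply Rle_trans with (2 * exp l * exp l / exp (2 * INR k)).
  { unfold Rdiv. apply Rmult_le_compat_l; [nra|]. apply Rinv_le_contravar; lra. }
  apply Rle_trans with (exp 1 * exp l * exp l / exp (2 * INR k)).
  { unfold Rdiv. apply Rmult_le_compat_r; [left; now apply Rinv_0_lt_compat|].
    assert (X := exp_1_ge_2). nra. }
  unfold Rdiv. rewrite <- exp_Ropp, <- !exp_plus. apply exp_le. lra.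
Qed.

(** At low energy the profile sum would grow from [N] by a factor [r >= exp (6 m)], past its maximum
    [N exp (5 m)]; [growth_lower] makes this conflict quantitative. *)
Lemma low_energy_bound :
  Ev N (t_of 10000 N) (fun d => Defs.ind _ (Rle_dec (energy N d) (INR N / 2))) empty_config
  <= exp (- (2 * l)).
Proof.
  assert (L := l_large). assert (N_pos := N_pos_large). assert (HN := INR_N_pos N N_pos).
  (* With [m] about [l / 100] the growth exponent [t m ^ 2 / (4 N)] is about [25 m]; after rounding
     it is still at most [28 m]. *)
  set (m := S (floorR (l / 100))).
  assert (Hm : l / 100 <= INR m <= l / 90).
  { unfold m. rewrite S_INR. destruct (floorR_spec (l / 100) ltac:(lra)). lra. }
  set (t := t_of 10000 N).
  assert (Ht : INR t <= 10000 * INR N / l < INR t + 1) by (apply t_of_spec; unfold l in *; lra).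
  assert (Nl : l ^ 2 <= INR N).
  { rewrite N_eq_exp. assert (X := pow_le_exp_fact l 3 ltac:(lra)). simpl in X |- *.
    assert (Y := exp_pos l). nra. }
  set (kappa := INR m ^ 2).
  assert (Hk : 0 <= kappa) by apply pow2_ge_0.
  set (r := (1 + kappa / (4 * INR N)) ^ t).
  assert (x0 : 0 <= kappa / (4 * INR N)) by (apply Rle_mult_inv_pos; lra).
  assert (r_up : r <= exp (28 * INR m)).
  { eapply Rle_trans; [now apply pow_one_plus_le|]. apply exp_le.
    apply Rle_trans with (10000 * INR N / l * (kappa / (4 * INR N))).
    - apply Rmult_le_compat_r; lra.
    - replace (10000 * INR N / l * (kappa / (4 * INR N))) with (2500 * kappa / l) by (field; lra).
      apply Rmult_le_reg_r with l; [lra|].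
      replace (2500 * kappa / l * l) with (2500 * kappa) by (field; lra).
      unfold kappa. nra. }
  assert (r_low : exp (6 * INR m) <= r).
  { apply Rle_trans with (exp (kappa / (8 * INR N)) ^ t).
    - rewrite exp_pow. apply exp_le.
      apply Rle_trans with ((9900 * INR N / l) * (kappa / (8 * INR N))).
      + replace (9900 * INR N / l * (kappa / (8 * INR N))) with (9900 / 8 * kappa / l)
          by (field; lra).
        apply Rmult_le_reg_r with l; [lra|].
        replace (9900 / 8 * kappa / l * l) with (9900 / 8 * kappa) by (field; lra).
        unfold kappa. nra.
      + apply Rmult_le_compat_r; [apply Rle_mult_inv_pos; lra|].
        (* Replacing [10000] by [9900] pays for the floor in [t]. *)
        assert (1 <= 100 * INR N / l).
        { apply Rmult_le_reg_r with l; [lra|].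
          replace (100 * INR N / l * l) with (100 * INR N) by (field; lra). nra. }
        replace (9900 * INR N / l) with (10000 * INR N / l - 100 * INR N / l) by (field; lra).
        lra.
    (* [exp x <= 1 + 2 x] bounds the growth from below at the price of halving the exponent. *)
    - apply pow_incr. split; [left; apply exp_pos|].
      replace (kappa / (4 * INR N)) with (2 * (kappa / (8 * INR N))) by (field; lra).
      apply exp_le_affine. split; [apply Rle_mult_inv_pos; lra|].
      apply Rmult_le_reg_r with (8 * INR N); [lra|].
      replace (kappa / (8 * INR N) * (8 * INR N)) with kappa by (field; lra).
      unfold kappa. nra. }
  (* [33 = 28 + 5] gives [C r exp (5 m) <= 1], and [33 m <= l / 2] keeps [C N] at least
     [exp (l / 2)]. *)
  set (C := exp (- (33 * INR m))).
  assert (HC : 0 < C) by apply exp_pos.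
  assert (CrP : C * r * exp (5 * INR m) <= 1).
  { apply Rle_trans with (C * exp (28 * INR m) * exp (5 * INR m)).
    - apply Rmult_le_compat_r; [left; apply exp_pos|]. apply Rmult_le_compat_l; lra.
    - unfold C. rewrite <- !exp_plus, <- exp_0. apply exp_le. lra. }
  eapply Rle_trans.
  { apply (growth_lower N kappa (exp (5 * INR m)) N_pos Hk
      (profile_le_exp m ltac:(unfold m; lia)) C t empty_config); [lra|exact CrP]. }
  rewrite sum_profile_empty. fold r.
  eapply Rle_trans; [|apply exp_double_exp_le; lra].
  apply exp_le, Ropp_le_contravar.
  assert (gap : 1 <= r - exp (5 * INR m)).
  { assert (X : 6 * INR m = 5 * INR m + INR m) by ring. rewrite X, exp_plus in r_low.
    assert (Y := exp_ineq1_le (INR m)). assert (Z := exp_ineq1_le (5 * INR m)). nra. }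
  apply Rle_trans with (C * INR N).
  - unfold C. rewrite N_eq_exp, <- exp_plus. apply exp_le. lra.
  - replace (C * (r * INR N - INR N * exp (5 * INR m)))
      with (C * INR N * (r - exp (5 * INR m))) by ring.
    assert (0 < C * INR N) by (apply Rmult_lt_0_compat; lra). nra.
Qed.

(* Columns of height at most [k] contribute at most [(k + 1) * total <= N / 4] to
   the energy, so high energy needs many columns higher than [k]. *)
Lemma high_energy_low_max_bound :
  Ev N (t_of 10000 N)
    (fun d => (1 - Defs.ind _ (Rle_dec (energy N d) (INR N / 2))) *
              (1 - Defs.ind _ (Rle_dec (Rpower (INR N) (/ 10240000)) (INR (maxh N d)))))
    empty_config
  <= exp (- (2 * l)).
Proof.
  assert (L := l_large). assert (N_pos := N_pos_large). assert (HN := INR_N_pos N N_pos).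
  destruct (floorR_spec (l / 640000) ltac:(lra)) as [k1 k2].
  (* With [q = k + 1], the constant [640000] gives both [q total <= N / 64] and a growth exponent of
     at most [q / 8]. *)
  set (k := pred (floorR (l / 640000))).
  assert (Sk : S k = floorR (l / 640000)).
  { unfold k. destruct (floorR (l / 640000)); [simpl in *; lra|reflexivity]. }
  rewrite <- Sk, S_INR in k1, k2.
  set (q := INR k + 1) in *.
  set (t := t_of 10000 N).
  assert (Ht : INR t <= 10000 * INR N / l) by (apply t_of_spec; unfold l in *; lra).
  (* This choice gives [m ^ 2 / rate k >= 2], hence a profile at [k] of at least
     [3 ^ k >= exp (q - 1)]. *)
  set (m := (2 * S k)%nat).
  assert (Hm : INR m = 2 * q) by (unfold m, q; rewrite mult_INR, (S_INR k); simpl; ring).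
  set (kappa := INR m ^ 2).
  assert (Hk : 0 <= kappa) by apply pow2_ge_0.
  set (r := (1 + 2 * kappa / INR N) ^ t).
  assert (r_up : r <= exp (q / 8)).
  { apply rate_drift_le; [exact N_pos|exact Hk|].
    apply Rle_trans with (10000 * INR N / l * (2 * kappa / INR N)).
    - apply Rmult_le_compat_r; [apply Rle_mult_inv_pos; lra|exact Ht].
    - replace (10000 * INR N / l * (2 * kappa / INR N)) with (20000 * kappa / l) by (field; lra).
      apply Rmult_le_reg_r with l; [lra|].
      replace (20000 * kappa / l * l) with (20000 * kappa) by (field; lra).
      unfold kappa. rewrite Hm. nra. }
  assert (r_low : 1 <= r).
  { apply pow_R1_Rle. assert (0 <= 2 * kappa / INR N) by (apply Rle_mult_inv_pos; lra). lra. }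
  set (Phi := profile kappa k).
  assert (HPhi : exp (q - 1) <= Phi).
  { unfold Phi. eapply Rle_trans; [|apply profile_lower with (k := k); [exact Hk|lia]].
    replace (q - 1) with (INR k * 1) by (unfold q; ring). rewrite <- exp_pow.
    apply pow_incr. split; [left; apply exp_pos|].
    eapply Rle_trans; [apply exp_le_3|].
    enough (2 <= kappa / rate k) by lra.
    assert (R1 := rate_ge_1 k).
    apply Rmult_le_reg_r with (rate k); [lra|].
    replace (kappa / rate k * rate k) with kappa by (field; lra).
    unfold kappa. rewrite Hm. unfold rate, q. rewrite S_INR. assert (X := pos_INR k). nra. }
  (* [11 q] exceeds [q / 8 + 5 m], where [5 m = 10 q], by at least [1], and [exp (- 1) <= 1/2]. *)
  set (C := exp (- (11 * q))).
  assert (HC : 0 < C) by apply exp_pos.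
  assert (CrP : C * r * exp (5 * INR m) <= / 2).
  { apply Rle_trans with (C * exp (q / 8) * exp (5 * INR m)).
    - apply Rmult_le_compat_r; [left; apply exp_pos|]. apply Rmult_le_compat_l; lra.
    - unfold C. rewrite Hm, <- !exp_plus.
      apply Rle_trans with (exp (- (1))); [apply exp_le; lra|].
      rewrite exp_Ropp. apply Rinv_le_contravar; [lra|apply exp_1_ge_2]. }
  assert (G := growth_upper N kappa (exp (5 * INR m)) N_pos Hk
     (profile_le_exp m ltac:(unfold m; lia)) C t empty_config ltac:(lra) CrP).
  fold r in G. rewrite sum_profile_empty in G.
  (* [10240000 = 16 * 640000], so [V ^ 2] is at most [exp ((q + 1) / 8)], far below [Phi]. *)
  set (V := Rpower (INR N) (/ 10240000)).
  assert (HV : V * V <= exp ((q + 1) / 8)).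
  { unfold V, Rpower. fold l. rewrite <- exp_plus. apply exp_le. lra. }
  assert (V0 : 0 < V) by apply exp_pos.
  (* On the event the profile sum is at least [2 r N], twice what [growth_upper] has in its
     exponent; this is Markov's inequality. *)
  apply Rle_trans with (Ev N t (fun d => exp (- (C * (2 * (r * INR N)))) *
       exp (C * profile_sum N kappa d)) empty_config).
  - apply Ev_le_reachable; [exact N_pos|]. intros d Hd.
    assert (Htot : total N d <= 10000 * INR N / l).
    { rewrite Hd. unfold total, empty_config. simpl (INR 0). rewrite bsum_const. lra. }
    set (Sd := profile_sum N kappa d).
    assert (E0 : 0 <= exp (- (C * (2 * (r * INR N)))) * exp (C * Sd)).
    { rewrite <- exp_plus. left. apply exp_pos. }
    unfold Defs.ind.
    destruct (Rle_dec (energy N d) (INR N / 2)) as [|HE]; [lra|].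
    destruct (Rle_dec V (INR (maxh N d))) as [|HM]; [lra|].
    replace ((1 - 0) * (1 - 0)) with 1 by ring.
    rewrite <- exp_plus, <- exp_0. apply exp_le.
    enough (2 * (r * INR N) <= Sd) by nra.
    assert (Phi0 : 0 < Phi) by (apply Rlt_le_trans with (2 := HPhi); apply exp_pos).
    (* A column up to height [k] costs at most [q] times its height; a taller one costs at most
       [V (V + 1) <= 2 V ^ 2], charged to its profile, which is at least [Phi]. *)
    assert (HQ : energy N d <= q * total N d + 2 * (V * V) / Phi * Sd).
    { unfold energy, total, Sd, profile_sum. rewrite <- !bsum_scal, <- bsum_plus.
      apply bsum_le. intros i Hi.
      assert (A := maxh_ge N d i Hi). apply le_INR in A.
      assert (B := profile_ge_1 kappa Hk (d i)).
      assert (D : 0 <= 2 * (V * V) / Phi) by (apply Rle_mult_inv_pos; nra).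
      assert (D0 := pos_INR (d i)).
      assert (Q0 : 0 < q) by (unfold q; assert (X := pos_INR k); lra).
      destruct (le_lt_dec (d i) k) as [Hi'|Hi'].
      - apply le_INR in Hi'. rewrite S_INR.
        assert (0 <= 2 * (V * V) / Phi * profile kappa (d i)) by nra.
        unfold q in *. nra.
      - assert (D1 : 1 <= INR (d i)) by (change 1 with (INR 1); apply le_INR; lia).
        assert (F : Phi <= profile kappa (d i)) by (apply profile_incr; [exact Hk|lia]).
        assert (2 * (V * V) <= 2 * (V * V) / Phi * profile kappa (d i)).
        { apply Rle_trans with (2 * (V * V) / Phi * Phi); [right; field; lra|].
          apply Rmult_le_compat_l; lra. }
        rewrite S_INR. nra. }
    assert (Hsmall : q * total N d <= INR N / 4).
    { apply Rle_trans with (l / 640000 * (10000 * INR N / l)).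
      - apply Rmult_le_compat; [unfold q; assert (X := pos_INR k); lra| |lra|exact Htot].
        unfold total. apply bsum_nonneg. intros; apply pos_INR.
      - replace (l / 640000 * (10000 * INR N / l)) with (INR N / 64) by (field; lra). lra. }
    assert (HS : INR N / 4 * Phi <= 2 * (V * V) * Sd).
    { replace (2 * (V * V) * Sd) with (2 * (V * V) / Phi * Sd * Phi) by (field; lra).
      apply Rmult_le_compat_r; lra. }
    assert (H16 : 16 * (V * V) * r <= Phi).
    { apply Rle_trans with (exp 4 * exp ((q + 1) / 8) * exp (q / 8)).
      - apply Rmult_le_compat; [nra|lra| |exact r_up].
        apply Rmult_le_compat; [lra|nra| |exact HV].
        replace 4 with (INR 4 * 1) by (simpl; ring). rewrite <- exp_pow.
        replace 16 with (2 ^ 4) by ring. apply pow_incr.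
        split; [lra|apply exp_1_ge_2].
      - eapply Rle_trans; [|exact HPhi]. rewrite <- !exp_plus. apply exp_le. lra. }
    assert (VV : 0 < V * V) by nra.
    apply Rmult_le_reg_l with (2 * (V * V)); [lra|].
    eapply Rle_trans; [|exact HS].
    replace (2 * (V * V) * (2 * (r * INR N))) with (INR N / 4 * (16 * (V * V) * r)) by field.
    apply Rmult_le_compat_l; lra.
  - rewrite Ev_scal by exact N_pos.
    eapply Rle_trans; [apply Rmult_le_compat_l; [left; apply exp_pos|exact G]|].
    rewrite <- exp_plus.
    eapply Rle_trans; [|apply exp_double_exp_le; lra]. apply exp_le.
    replace (- (C * (2 * (r * INR N))) + C * r * INR N) with (- (C * INR N * r)) by ring.
    apply Ropp_le_contravar.
    apply Rle_trans with (C * INR N).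
    + unfold C. rewrite N_eq_exp, <- exp_plus. apply exp_le. lra.
    + assert (0 < C * INR N) by (apply Rmult_lt_0_compat; lra). nra.
Qed.

End Large.

(** * Union bound and summable error *)

Lemma ind_bounds (b : Prop) (d : {b} + {~ b}) : 0 <= Defs.ind b d <= 1.
Proof. unfold Defs.ind. destruct d; lra. Qed.

Lemma t_of_incr a b N :
  0 <= a -> a <= b -> 1 <= ln (INR N) -> 0 < INR N -> (t_of a N <= t_of b N)%nat.
Proof.
  intros Ha Hab Hl HN.
  destruct (t_of_spec a N Ha Hl HN) as [A _].
  destruct (t_of_spec b N ltac:(lra) Hl HN) as [_ B].
  apply Nat.lt_succ_r, INR_lt. rewrite S_INR.
  enough (a * INR N / ln (INR N) <= b * INR N / ln (INR N)) by lra.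
  apply Rmult_le_compat_r; [left; apply Rinv_0_lt_compat; lra|].
  apply Rmult_le_compat_r; lra.
Qed.

(** Serves the finitely many small [N], where the error term is [1]. *)
Lemma event_prob_nonneg N a b chi : (0 < N)%nat -> 0 <= event_prob N a b chi.
Proof.
  intros HN. unfold event_prob.
  rewrite <- (Ev_const N HN (t_of a N) 0 empty_config). apply Ev_le; [exact HN|]. intros c.
  apply Rmult_le_pos; [apply ind_bounds|].
  rewrite <- (Ev_const N HN (t_of b N - t_of a N) 0 c). apply Ev_le; [exact HN|].
  intros d. apply ind_bounds.
Qed.

(** Union bound over a tall column early, low energy late, and high energy late without a column of
    height [N ^ chi]. *)
Lemma event_prob_large N :
  10 ^ 7 <= ln (INR N) ->
  1 - 3 * exp (- (2 * ln (INR N))) <= event_prob N (/ 288) 10000 (/ 10240000).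
Proof.
  intros HN. assert (N_pos := N_pos_large N HN).
  assert (N0 := INR_N_pos N N_pos).
  set (l := ln (INR N)) in *.
  assert (Htt : (t_of (/ 288) N <= t_of 10000 N)%nat) by (apply t_of_incr; fold l; lra).
  assert (P1 := early_max_bound N HN). assert (P2 := low_energy_bound N HN).
  assert (P3 := high_energy_low_max_bound N HN). fold l in P1, P2, P3.
  unfold event_prob. fold l.
  set (a := fun c => Defs.ind _ (Rle_dec (INR (maxh N c)) (3 * l))) in *.
  set (b := fun d => Defs.ind _ (Rle_dec (Rpower (INR N) (/ 10240000)) (INR (maxh N d)))) in *.
  set (e := fun d => Defs.ind _ (Rle_dec (energy N d) (INR N / 2))) in *.
  set (t1 := t_of (/ 288) N) in *. set (t2 := t_of 10000 N) in *.
  change (Ev N t1 (fun c => 1 - a c) empty_config <= exp (- (2 * l))) in P1.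
  change (Ev N t2 (fun d => (1 - e d) * (1 - b d)) empty_config <= exp (- (2 * l))) in P3.
  assert (B : 1 - 2 * exp (- (2 * l)) <= Ev N t2 b empty_config).
  { apply Rle_trans with (Ev N t2 (fun d => 1 + -1 * (e d + (1 - e d) * (1 - b d))) empty_config).
    - rewrite !Ev_plus, Ev_const, Ev_scal, Ev_plus by exact N_pos.
      change (Ev N t2 e empty_config <= exp (- (2 * l))) in P2. lra.
    - apply Ev_le; [exact N_pos|]. intros d.
      assert (X : 0 <= e d <= 1) by apply ind_bounds.
      assert (Y : 0 <= b d <= 1) by apply ind_bounds. nra. }
  (* The inner expectation is at most [1], so multiplying it by [a] loses at most [1 - a];
     [Ev_compose] merges the two stages into time [t2]. *)
  apply Rle_trans with (Ev N t1 (fun c => Ev N (t2 - t1) b c + -1 * (1 - a c)) empty_config).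
  - rewrite Ev_plus, Ev_scal, Ev_compose by exact N_pos.
    replace (t1 + (t2 - t1))%nat with t2 by lia. lra.
  - apply Ev_le; [exact N_pos|]. intros c.
    assert (X : 0 <= a c <= 1) by apply ind_bounds.
    assert (Y : Ev N (t2 - t1) b c <= 1).
    { rewrite <- (Ev_const N N_pos (t2 - t1) 1 c). apply Ev_le; [exact N_pos|].
      intros d. apply ind_bounds. }
    change (Ev N (t2 - t1) b c + -1 * (1 - a c) <= a c * Ev N (t2 - t1) b c). nra.
Qed.

(** For [N >= 2] the tail dominates [3 / N ^ 2], the error in [event_prob_large], and it telescopes
    as [12 / (N + 1) - 12 / (N + 2)]. *)
Definition error_term (N0 N : nat) : R :=
  if Nat.ltb N N0 then 1 else 12 / (INR (S N) * INR (S (S N))).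

Lemma error_term_nonneg N0 N : 0 <= error_term N0 N.
Proof.
  unfold error_term. destruct (Nat.ltb N N0); [lra|].
  apply Rle_mult_inv_pos; [lra|]. apply Rmult_lt_0_compat; apply lt_0_INR; lia.
Qed.

Lemma error_term_summable N0 : exists l, infinite_sum (error_term N0) l.
Proof.
  destruct (bounded_series_cv (error_term N0) (INR N0 + 12)) as [l Hl].
  - apply error_term_nonneg.
  - intros M.
    enough (bsum M (error_term N0) <= INR (Nat.min M N0) + 12 * (1 - / INR (S M))).
    { assert (A : INR (Nat.min M N0) <= INR N0) by (apply le_INR; lia).
      assert (B : 0 < / INR (S M)) by (apply Rinv_0_lt_compat, lt_0_INR; lia). lra. }
    induction M as [|M IH]; [simpl; lra|]. cbn [bsum].
    assert (Q := pos_INR M).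
    assert (D : 12 * (1 - / INR (S (S M)))
        = 12 * (1 - / INR (S M)) + 12 / (INR (S M) * INR (S (S M)))).
    { rewrite !S_INR. field. lra. }
    unfold error_term at 2. destruct (Nat.ltb_spec M N0) as [HM|HM].
    + rewrite (Nat.min_l (S M)) by lia. rewrite Nat.min_l in IH by lia.
      assert (E : 0 <= 12 / (INR (S M) * INR (S (S M)))).
      { apply Rle_mult_inv_pos; [lra|]. apply Rmult_lt_0_compat; apply lt_0_INR; lia. }
      rewrite D. assert (F := S_INR M). lra.
    + rewrite (Nat.min_r (S M)) by lia. rewrite Nat.min_r in IH by lia. lra.
  - exists l. change (Un_cv (sum_f_R0 (error_term N0)) l).
    apply (Un_cv_ext (fun M => bsum (S M) (error_term N0))).
    + intros; symmetry; apply sum_f_R0_bsum.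
    + now apply Un_cv_shift in Hl.
Qed.

Theorem theorem1p1 :
  exists alpha beta chi : R,
    0 < alpha /\ alpha < beta /\ 0 < chi /\
    exists eps : nat -> R,
      (forall N, 0 <= eps N) /\
      (exists l, infinite_sum eps l) /\
      (forall N : nat, (2 <= N)%nat -> 1 - eps N <= event_prob N alpha beta chi).
Proof.
  (* The constants of [early_max_bound], [low_energy_bound] and [high_energy_low_max_bound]. *)
  exists (/ 288), 10000, (/ 10240000). split; [lra|]. split; [lra|]. split; [lra|].
  destruct (INR_unbounded (exp (10 ^ 7))) as [N0 HN0].
  exists (error_term N0). split; [apply error_term_nonneg|].
  split; [apply error_term_summable|]. intros N HN.
  assert (N_pos : 0 < INR N) by (apply lt_0_INR; lia).
  unfold error_term. destruct (Nat.ltb_spec N N0) as [H|H].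
  - rewrite Rminus_diag. apply event_prob_nonneg. lia.
  - eapply Rle_trans; [|apply event_prob_large].
    + apply Rplus_le_compat_l, Ropp_le_contravar.
      replace (- (2 * ln (INR N))) with (- ln (INR N) + - ln (INR N)) by ring.
      rewrite exp_plus, exp_Ropp, exp_ln by exact N_pos.
      assert (N2 : 2 <= INR N) by (change 2 with (INR 2); now apply le_INR).
      rewrite !S_INR.
      apply Rmult_le_reg_r with (INR N * INR N * ((INR N + 1) * (INR N + 1 + 1))).
      { repeat apply Rmult_lt_0_compat; lra. }
      field_simplify; [nra|lra|lra].
    + rewrite <- (ln_exp (10 ^ 7)). left. apply ln_increasing; [apply exp_pos|].
      apply le_INR in H. lra.
Qed.
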